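(* Let $p$ be a prime and $\mathbf{k}$ a field of characteristic $p$. Define $\ell_{i,p}(q)\in\mathbb{Z}[[q]]$ for $i\ge 0$ by $$\ell_{i,2}(q)=\prod_{j=1}^i\frac{q^{2^j-1}}{1-q^{2^j-1}},\qquad \ell_{i,p}(q)=\prod_{j=1}^i\frac{q^{2p^{j-1}(p-1)-1}+q^{2(p^j-1)}}{1-q^{2(p^j-1)}}\quad (p\text{ odd}),$$ (so $\ell_{0,p}=1$), and define integers $N_p(m,d)$, $m,d\ge 0$, by the identity of formal power series $$\sum_{m,d=0}^\infty N_p(m,d)t^mq^d=\frac{1}{\sum_{i=0}^\infty(-1)^it^i\ell_{i,p}(q)}.$$ Then for all integers $n\ge 0$ and $d\ge 0$, $$\dim_{\mathbf{k}}\mathcal{E}_n(p)_d=\sum_{m=0}^nN_p(m,d),\qquad \dim_{\mathbf{k}}\mathcal{E}_\infty(p)_d=\sum_{m=0}^\infty N_p(m,d).$$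
   Context: For a $\mathbb{Z}[\frac1p]$-graded $\mathbf{k}$-algebra $R$, $\mathrm{Int}(R)=\bigoplus_{m\in\mathbb{Z}}R_m$ is the $\mathbb{Z}$-graded subalgebra of elements of integer degree. For $p=2$: $R(n,2)=\mathbf{k}[x_1,\dots,x_n]$ with $|x_i|=\frac{2^i-1}{2^i}$, and $\mathcal{E}_n(2)=\mathrm{Int}(R(n,2))$. For $p$ odd: $R(n,p)=\mathbf{k}[x_1,\dots,x_n]\otimes\Lambda(\xi_1,\dots,\xi_n)$ (polynomial tensor exterior algebra) with $|x_i|=\frac{2(p^i-1)}{p^i}$, $|\xi_i|=\frac{p^i-2}{p^i}$, and $\mathcal{E}_n(p)=\mathrm{Int}(R(n,p))$. In particular $\mathcal{E}_0(p)=\mathbf{k}$. The subscript $d$ denotes the homogeneous component of degree $d$. There are inclusions $\mathcal{E}_{n-1}(p)\to\mathcal{E}_n(p)$ sending each generator to the generator of the same name, and $\mathcal{E}_\infty(p)=\varinjlim_n\mathcal{E}_n(p)$. *)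

(* Defs.v *)
From HB Require Import structures.
From mathcomp Require Import all_boot all_order all_algebra.
From mathcomp Require Import generic_quotient boolp ring.
From mathcomp Require Import mpoly.

Set Implicit Arguments.
Unset Strict Implicit.
Unset Printing Implicit Defensive.

Import Order.TTheory GRing.Theory Num.Theory.
Local Open Scope ring_scope.
Local Open Scope quotient_scope.

(* Formal power series A[[X]] over a commutative ring; [fps (fps int)] is
   Z[[q]][[t]], with outer variable t. *)
Record fps (A : Type) := Fps { fps_coef :> nat -> A }.

HB.instance Definition _ (A : Type) := gen_eqMixin (fps A).
HB.instance Definition _ (A : Type) := gen_choiceMixin (fps A).

Lemma fpsP (A : Type) (f g : fps A) : f =1 g -> f = g.
Proof. by case: f g => [f] [g] /= /funext ->. Qed.

Section FpsZmod.
Variable A : zmodType.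
Implicit Types f g h : fps A.

Definition fps_zero : fps A := Fps (fun=> 0).
Definition fps_opp f : fps A := Fps (fun n => - f n).
Definition fps_add f g : fps A := Fps (fun n => f n + g n).

Fact fps_addA : associative fps_add.
Proof. by move=> f g h; apply: fpsP => n /=; rewrite addrA. Qed.
Fact fps_addC : commutative fps_add.
Proof. by move=> f g; apply: fpsP => n /=; rewrite addrC. Qed.
Fact fps_add0 : left_id fps_zero fps_add.
Proof. by move=> f; apply: fpsP => n /=; rewrite add0r. Qed.
Fact fps_addN : left_inverse fps_zero fps_opp fps_add.
Proof. by move=> f; apply: fpsP => n /=; rewrite addNr. Qed.

HB.instance Definition _ :=
  GRing.isZmodule.Build (fps A) fps_addA fps_addC fps_add0 fps_addN.
End FpsZmod.

Section FpsRing.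
Variable A : comNzRingType.
Implicit Types f g h : fps A.

Definition fps_one : fps A := Fps (fun n => (n == 0)%N%:R).
Definition fps_mul f g : fps A :=
  Fps (fun n => \sum_(i < n.+1) f i * g (n - i)%N).

Fact fps_mulC : commutative fps_mul.
Proof.
move=> f g; apply: fpsP => n /=; rewrite (reindex_inj rev_ord_inj) /=.
apply: eq_bigr => i _; have lein : (i <= n)%N by rewrite -ltnS.
by rewrite subSS (subKn lein) [LHS]mulrC.
Qed.

Let trunc n f : {poly A} := \poly_(i < n.+1) f i.

Let mul_trunc n m f g : (m <= n)%N ->
  fps_mul f g m = (trunc n f * trunc n g)`_m.
Proof.
move=> lemn; rewrite coefM; apply: eq_bigr => i _.
have lein : (i < n.+1)%N by rewrite (leq_trans (ltn_ord i)).
by rewrite !coef_poly lein ltnS (leq_trans (leq_subr _ _)).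
Qed.

Fact fps_mulA : associative fps_mul.
Proof.
move=> f g h; apply: fpsP => n; rewrite !(mul_trunc _ _ (leqnn n)).
transitivity (trunc n f * (trunc n g * trunc n h))`_n.
  rewrite !coefM; apply: eq_bigr => i _; congr (_ * _).
  by rewrite coef_poly ltnS leq_subr; apply/mul_trunc/leq_subr.
rewrite mulrA !coefM; apply: eq_bigr => i _; congr (_ * _).
by rewrite coef_poly ltn_ord; apply/esym/mul_trunc; rewrite -ltnS.
Qed.

Fact fps_mul1 : left_id fps_one fps_mul.
Proof.
move=> f; apply: fpsP => n /=; rewrite big_ord_recl /= subn0 mul1r.
by rewrite big1 ?addr0 // => i _; rewrite mul0r.
Qed.

Fact fps_mulDl : left_distributive fps_mul +%R.
Proof.
move=> f g h; apply: fpsP => n /=; rewrite -big_split.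
by apply: eq_bigr => i _; rewrite mulrDl.
Qed.

Fact fps_one_neq0 : fps_one != 0.
Proof. by apply/eqP => /(congr1 (fun h : fps A => h 0%N))/eqP; rewrite oner_eq0. Qed.

HB.instance Definition _ := GRing.Zmodule_isComNzRing.Build (fps A)
  fps_mulA fps_mulC fps_mul1 fps_mulDl fps_one_neq0.

Definition fps_X : fps A := Fps (fun n => (n == 1)%N%:R).
End FpsRing.

Section FpsUnit.
Variable A : comUnitRingType.
Implicit Types f g : fps A.

Definition fps_unit : {pred fps A} := fun f => f 0%N \is a GRing.unit.

Fixpoint fps_inv_seq f n : seq A :=
  if n is n'.+1 then
    let s := fps_inv_seq f n' in
    rcons s (- (f 0%N)^-1 * \sum_(i < n'.+1) s`_i * f (n'.+1 - i)%N)
  else [:: (f 0%N)^-1].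

Definition fps_inv f : fps A :=
  if fps_unit f then Fps (fun n => (fps_inv_seq f n)`_n) else f.

Let size_inv_seq f n : size (fps_inv_seq f n) = n.+1.
Proof. by elim: n => //= n IH; rewrite size_rcons IH. Qed.

Let inv_seqE f n i : (i <= n)%N ->
  (fps_inv_seq f n)`_i = (fps_inv_seq f i)`_i.
Proof.
elim: n => [|n IH]; first by case: i.
rewrite leq_eqVlt => /orP[/eqP -> //|ltin].
by rewrite /= nth_rcons size_inv_seq ltin IH.
Qed.

Fact fps_mulVx : {in fps_unit, left_inverse 1 fps_inv *%R}.
Proof.
move=> f Uf; rewrite /fps_inv (Uf : fps_unit f); apply: fpsP => -[|n].
  by rewrite /= big_ord1 mulVr.
rewrite /= big_ord_recr /= subnn nth_rcons size_inv_seq ltnn eqxx.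
rewrite mulrC mulrA mulrN mulrV // mulN1r; apply/eqP; rewrite subr_eq0.
by apply/eqP/eq_bigr => i _; rewrite (@inv_seqE f n i) ?leq_ord.
Qed.

Fact fps_unitPl f g : g * f = 1 -> fps_unit f.
Proof.
move/(congr1 (fun h : fps A => h 0%N)); rewrite /= big_ord1 subn0 => gf1.
by apply/unitrPr; exists (g 0%N); rewrite mulrC.
Qed.

Fact fps_inv_out : {in [predC fps_unit], fps_inv =1 id}.
Proof. by move=> f; rewrite inE /fps_inv => /negbTE; rewrite /in_mem /= => ->. Qed.

HB.instance Definition _ := GRing.ComNzRing_hasMulInverse.Build (fps A)
  fps_mulVx fps_unitPl fps_inv_out.
End FpsUnit.

Record is_grading (k : fieldType) (I : zmodType) (A : algType k)
    (H : I -> A -> Prop) : Prop := IsGrading {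
  grading_submod0 : forall i, H i 0;
  grading_linear : forall i a x y, H i x -> H i y -> H i (a *: x + y);
  grading_one : H 0 1;
  grading_mul : forall i j x y, H i x -> H j y -> H (i + j) (x * y);
  grading_span : forall x, exists s : seq A,
    (forall y, y \in s -> exists i, H i y) /\ x = \sum_(y <- s) y;
  grading_direct : forall (s : seq I) (c : I -> A), uniq s ->
    (forall i, i \in s -> H i (c i)) -> \sum_(i <- s) c i = 0 ->
    forall i, i \in s -> c i = 0
}.

Record gralg (k : fieldType) (I : zmodType) := GrAlg {
  gr_alg :> algType k;
  gr_comp : I -> gr_alg -> Prop;
  gr_ax : is_grading gr_comp
}.

Record grmor (k : fieldType) (I : zmodType) (A B : gralg k I) := GrMor {
  gr_fun :> {lrmorphism A -> B};
  gr_fun_comp : forall i x, gr_comp i x -> gr_comp i (gr_fun x)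
}.

(* Int(R), the sum of the components of integer degree.  Degrees in Z[1/p]
   are recorded in [rat]. *)
Section IntSub.
Variables (k : fieldType) (A : gralg k rat).

Definition int_deg (x : A) : Prop := exists m : int, gr_comp m%:~R x.

Definition int_pred : {pred A} := fun x =>
  `[< exists s : seq A,
        (forall y, y \in s -> int_deg y) /\ x = \sum_(y <- s) y >].

Lemma int_predP (x : A) : reflect
  (exists s : seq A, (forall y, y \in s -> int_deg y) /\ x = \sum_(y <- s) y)
  (x \in int_pred).
Proof. exact: asboolP. Qed.

Lemma int_pred_deg (x : A) : int_deg x -> x \in int_pred.
Proof.
move=> xP; apply/int_predP; exists [:: x].
by rewrite big_seq1; split => // y; rewrite inE => /eqP ->.
Qed.

Lemma int_predD (x y : A) :
  x \in int_pred -> y \in int_pred -> x + y \in int_pred.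
Proof.
move=> /int_predP[s [sP ->]] /int_predP[t [tP ->]]; apply/int_predP.
exists (s ++ t); rewrite big_cat; split=> // z.
by rewrite mem_cat => /orP[/sP|/tP].
Qed.

Lemma int_pred0 : 0 \in int_pred.
Proof. by apply: int_pred_deg; exists 0; apply: grading_submod0 (gr_ax A) _. Qed.

Lemma int_pred_sum (T : eqType) (s : seq T) (F : T -> A) :
  (forall i, i \in s -> F i \in int_pred) -> \sum_(i <- s) F i \in int_pred.
Proof.
move=> FP; rewrite big_seq; elim/big_ind: _ => //.
  exact: int_pred0.
exact: int_predD.
Qed.

Fact int_pred_subalg : subalg_closed int_pred.
Proof.
split.
- apply: int_pred_deg; exists 0; exact: grading_one (gr_ax A).
- move=> a x y /int_predP[s [sP ->]] yP; apply: int_predD => //.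
  rewrite scaler_sumr; apply: int_pred_sum => z /sP[m zm].
  apply: int_pred_deg; exists m; rewrite -[_ *: _]addr0.
  by apply: (grading_linear (gr_ax A)) => //; apply: grading_submod0 (gr_ax A) _.
- move=> x y /int_predP[s [sP ->]] /int_predP[t [tP ->]].
  rewrite mulr_suml; apply: int_pred_sum => z /sP[m zm].
  rewrite mulr_sumr; apply: int_pred_sum => u /tP[n un].
  by apply: int_pred_deg; exists (m + n); rewrite intrD; apply: (grading_mul (gr_ax A)).
Qed.

HB.instance Definition _ :=
  GRing.isSubalgClosed.Build k A int_pred
    (GRing.subalg_closed_semi int_pred_subalg).

Record int_alg := IntAlg { int_val : A; int_valP : int_val \in int_pred }.

HB.instance Definition _ := [isSub for int_val].
HB.instance Definition _ := [Choice of int_alg by <:].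
HB.instance Definition _ := [SubChoice_isSubAlgebra of int_alg by <:].

Definition int_comp (m : int) (x : int_alg) : Prop := gr_comp m%:~R (int_val x).

Fact int_grading : is_grading int_comp.
Proof.
have [H0 Hlin H1 HM Hspan Hdir] := gr_ax A.
split; rewrite /int_comp.
- by move=> i; exact: H0.
- by move=> i a x y Hx Hy; exact: Hlin.
- exact: H1.
- by move=> i j x y Hx Hy; rewrite intrD; exact: HM.
- case=> x xP; have /int_predP[s [sP xE]] := xP.
  have [t tE]: exists t : seq int_alg, s = map int_val t.
    elim: s sP {xP xE} => [|y s IH] sP; first by exists [::].
    have [z zs|t ->] := IH _; first by apply: sP; rewrite inE zs orbT.
    have yP : y \in int_pred by apply/int_pred_deg/sP; rewrite inE eqxx.
    by exists (IntAlg yP :: t).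
  exists t; split.
    by move=> y yt; apply: sP; rewrite tE map_f.
  by apply/val_inj; rewrite raddf_sum /= xE tE big_map.
- move=> s c us sP sc0 i is_; apply/val_inj.
  pose c' r := int_val (c (numq r)).
  have c'E m : c' m%:~R = int_val (c m) by rewrite /c' numq_int.
  rewrite /= -c'E; apply: (Hdir [seq m%:~R | m <- s] c').
  + by rewrite map_inj_uniq //; exact: intr_inj.
  + by move=> r /mapP[m ms ->]; rewrite c'E; apply: sP.
  + rewrite big_map; move/(congr1 val): sc0; rewrite raddf_sum /= => sc0.
    by rewrite -[RHS]sc0; apply: eq_bigr => m _; rewrite c'E.
  + exact: map_f.
Qed.

Definition IntGr : gralg k int := GrAlg int_grading.
End IntSub.

Section IntMap.
Variables (k : fieldType) (A B : gralg k rat) (f : grmor A B).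

Fact int_map_subproof (x : IntGr A) : f (int_val x) \in @int_pred k B.
Proof.
have /int_predP[s [sP ->]] := int_valP x; rewrite raddf_sum.
apply: int_pred_sum => y /sP[m ym]; apply: int_pred_deg.
by exists m; apply: gr_fun_comp.
Qed.

Definition int_map (x : IntGr A) : IntGr B := IntAlg (int_map_subproof x).

Fact int_map_zmod : zmod_morphism int_map.
Proof. by move=> x y; apply/val_inj; rewrite /= raddfB. Qed.
Fact int_map_monoid : monoid_morphism int_map.
Proof. by split=> [|x y]; apply/val_inj; rewrite /= (rmorph1, rmorphM). Qed.
Fact int_map_scalable : scalable int_map.
Proof. by move=> a x; apply/val_inj; rewrite /= linearZ. Qed.

HB.instance Definition _ :=
  GRing.isZmodMorphism.Build (IntGr A) (IntGr B) int_map int_map_zmod.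
HB.instance Definition _ :=
  GRing.isMonoidMorphism.Build (IntGr A) (IntGr B) int_map int_map_monoid.
HB.instance Definition _ :=
  GRing.isScalable.Build k (IntGr A) (IntGr B) *:%R int_map int_map_scalable.

Definition IntGr_map : grmor (IntGr A) (IntGr B) :=
  @GrMor k int (IntGr A) (IntGr B) int_map
    (fun m x => @gr_fun_comp _ _ _ _ f m%:~R (int_val x)).
End IntMap.

(* Direct limit of a sequence of graded algebras E 0 -> E 1 -> ... :
   pairs (n, a) with a in E n, where (n, a) and (m, b) are identified as soon
   as they have the same image in some E N. *)
Section Colim.
Variables (k : fieldType) (I : zmodType).
Variables (E : nat -> gralg k I) (f : forall n, grmor (E n) (E n.+1)).

(* The composite E n -> E m for n <= m; the value is junk for m < n. *)
Fixpoint push (n m : nat) (a : E n) : E m :=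
  match n =P m with
  | ReflectT e => ecast i (E i) e a
  | ReflectF _ => match m with
                  | 0 => 0
                  | m'.+1 => f m' (push m' a)
                  end
  end.

Lemma push_id n (a : E n) : push n a = a.
Proof.
by case: n a => [|n] a /=; case: eqP => // e; rewrite (eq_irrelevance e erefl).
Qed.

Lemma pushS n m (a : E n) : (n <= m)%N -> push m.+1 a = f m (push m a).
Proof.
move=> lenm /=; case: eqP => // e; exfalso.
by move: lenm; apply/negP; rewrite -ltnNge -e.
Qed.

Lemma push_push n m l (a : E n) :
  (n <= m)%N -> (m <= l)%N -> push l (push m a) = push l a.
Proof.
move=> lenm; elim: l => [|l IH].
  by rewrite leqn0 => /eqP m0; subst m; rewrite push_id.
rewrite leq_eqVlt => /orP[/eqP ml|]; first by subst m; rewrite push_id.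
by rewrite ltnS => leml; rewrite !pushS ?(leq_trans lenm) ?IH.
Qed.

Section PushMorphism.
Variables (n m : nat) (lenm : (n <= m)%N).

Let push_ind (P : forall m, (E n -> E m) -> Prop) :
  P n id -> (forall m g, (n <= m)%N -> P m g -> P m.+1 (fun a => f m (g a))) ->
  (forall m g h, g =1 h -> P m g -> P m h) -> P m (@push n m).
Proof.
move=> P0 PS Pe; elim: m lenm => [|l IH].
  rewrite leqn0 => /eqP n0; subst n.
  by apply: Pe P0 => a; rewrite push_id.
rewrite leq_eqVlt => /orP[/eqP nl|].
  by subst n; apply: Pe P0 => a; rewrite push_id.
rewrite ltnS => lenl; apply: Pe (PS _ _ lenl (IH lenl)) => a.
by rewrite pushS.
Qed.

Lemma push_lin c (a b : E n) : push m (c *: a + b) = c *: push m a + push m b.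
Proof.
pose P l (g : E n -> E l) := g (c *: a + b) = c *: g a + g b.
apply: (@push_ind P) => // [l g _|l g h gh]; rewrite /P; first by move=> ->; rewrite linearP.
by rewrite !gh.
Qed.

Lemma pushM (a b : E n) : push m (a * b) = push m a * push m b.
Proof.
pose P l (g : E n -> E l) := g (a * b) = g a * g b.
apply: (@push_ind P) => // [l g _|l g h gh]; rewrite /P; first by move=> ->; rewrite rmorphM.
by rewrite !gh.
Qed.

Lemma push1 : push m (1 : E n) = 1.
Proof.
pose P l (g : E n -> E l) := g 1 = 1.
apply: (@push_ind P) => // [l g _|l g h gh]; rewrite /P; first by move=> ->; rewrite rmorph1.
by rewrite !gh.
Qed.

Lemma push_comp i (a : E n) : gr_comp i a -> gr_comp i (push m a).
Proof.
move=> ai; pose P l (g : E n -> E l) := gr_comp i (g a).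
apply: (@push_ind P) => // [l g _|l g h gh]; rewrite /P; first exact: gr_fun_comp.
by rewrite gh.
Qed.

Lemma pushD (a b : E n) : push m (a + b) = push m a + push m b.
Proof. by rewrite -[a]scale1r push_lin !scale1r. Qed.

Lemma push0 : push m (0 : E n) = 0.
Proof. by apply: (addrI (push m (0 : E n))); rewrite -pushD !addr0. Qed.

Lemma pushZ c (a : E n) : push m (c *: a) = c *: push m a.
Proof. by rewrite -[c *: a]addr0 push_lin push0 addr0. Qed.

Lemma pushN (a : E n) : push m (- a) = - push m a.
Proof. by rewrite -scaleN1r pushZ scaleN1r. Qed.

Lemma push_sum (T : Type) (s : seq T) (F : T -> E n) :
  push m (\sum_(i <- s) F i) = \sum_(i <- s) push m (F i).
Proof. exact: (big_morph (@push n m) pushD push0). Qed.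
End PushMorphism.

Definition colim_rel (u v : {n : nat & E n}) : bool :=
  `[< exists N, [/\ (tag u <= N)%N, (tag v <= N)%N &
                   push N (tagged u) = push N (tagged v)] >].

Fact colim_rel_refl : reflexive colim_rel.
Proof. by move=> u; apply/asboolP; exists (tag u). Qed.

Fact colim_rel_sym : ssrbool.symmetric colim_rel.
Proof. by move=> u v; apply/asboolP/asboolP => -[N [? ? ?]]; exists N. Qed.

Fact colim_rel_trans : transitive colim_rel.
Proof.
move=> v u w /asboolP[N [uN vN uv]] /asboolP[M [vM wM vw]]; apply/asboolP.
have [NK MK] := (leq_maxl N M, leq_maxr N M); exists (maxn N M).
split; [exact: leq_trans NK | exact: leq_trans MK |].
rewrite -(push_push _ uN NK) uv (push_push _ vN NK).
by rewrite -(push_push _ vM MK) vw (push_push _ wM MK).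
Qed.

Canonical colim_equiv :=
  EquivRel colim_rel colim_rel_refl colim_rel_sym colim_rel_trans.

Definition colim := {eq_quot colim_equiv}.
HB.instance Definition _ := Choice.on colim.

Definition colim_in (n : nat) (a : E n) : colim :=
  \pi_{eq_quot colim_equiv} (existT (fun n => E n) n a).

Lemma colim_inP n m (a : E n) (b : E m) : colim_in a = colim_in b <->
  exists N, [/\ (n <= N)%N, (m <= N)%N & push N a = push N b].
Proof.
split=> [/eqmodP/asboolP //|h].
by apply/eqmodP/asboolP.
Qed.

Lemma colim_in_push n m (a : E n) : (n <= m)%N -> colim_in (push m a) = colim_in a.
Proof. by move=> lenm; apply/colim_inP; exists m; rewrite push_id. Qed.

Lemma colim_inS n (a : E n) : colim_in (f n a) = colim_in a.
Proof. by rewrite -(colim_in_push a (leqnSn n)) pushS // push_id. Qed.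

Lemma colim_lift (z : colim) : exists n (a : E n), z = colim_in a.
Proof.
elim/quotW: z => -[n a]; exists n, a; reflexivity.
Qed.

Definition colim_rep (z : colim) : {n : nat & E n} := repr z.

Lemma colim_repK z : colim_in (tagged (colim_rep z)) = z.
Proof.
by rewrite /colim_in /colim_rep; case: (repr z) (reprK z) => n a /= <-.
Qed.

Definition colim_op2 (op : forall n, E n -> E n -> E n) (z w : colim) : colim :=
  let u := colim_rep z in let v := colim_rep w in
  let N := maxn (tag u) (tag v) in
  colim_in (op N (push N (tagged u)) (push N (tagged v))).

Definition colim_op1 (op : forall n, E n -> E n) (z : colim) : colim :=
  colim_in (op _ (tagged (colim_rep z))).

Lemma colim_op2E (op : forall n, E n -> E n -> E n) :
  (forall n m (a b : E n), (n <= m)%N ->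
     push m (op n a b) = op m (push m a) (push m b)) ->
  forall n (a b : E n), colim_op2 op (colim_in a) (colim_in b) = colim_in (op n a b).
Proof.
move=> opP n a b; rewrite /colim_op2.
move: (colim_repK (colim_in a)) (colim_repK (colim_in b)).
case: (colim_rep _) => na a' /=; case: (colim_rep _) => nb b' /=.
move=> /colim_inP[N [aN nN a'a]] /colim_inP[M [bM nM b'b]].
set K := maxn na nb; apply/colim_inP; exists (maxn K (maxn N M)).
set L := maxn K _.
have [KL NL ML] : [/\ (K <= L)%N, (N <= L)%N & (M <= L)%N].
  rewrite /L leq_maxl; split=> //; apply: leq_trans (leq_maxr _ _);
  [exact: leq_maxl | exact: leq_maxr].
have nL := leq_trans nN NL.
split=> //; rewrite !opP // !push_push ?leq_maxl ?leq_maxr //.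
rewrite -(push_push _ aN NL) a'a (push_push _ nN NL).
by rewrite -(push_push _ bM ML) b'b (push_push _ nM ML).
Qed.

Lemma colim_op1E (op : forall n, E n -> E n) :
  (forall n m (a : E n), (n <= m)%N -> push m (op n a) = op m (push m a)) ->
  forall n (a : E n), colim_op1 op (colim_in a) = colim_in (op n a).
Proof.
move=> opP n a; rewrite /colim_op1.
move: (colim_repK (colim_in a)); case: (colim_rep _) => na a' /=.
move=> /colim_inP[N [aN nN a'a]]; apply/colim_inP; exists N.
by rewrite !opP // a'a.
Qed.

Definition colim_add := colim_op2 (fun n => +%R).
Definition colim_mul := colim_op2 (fun n => *%R).
Definition colim_opp := colim_op1 (fun n => -%R).
Definition colim_scale (c : k) := colim_op1 (fun n => *:%R c).
Definition colim_zero : colim := colim_in (0 : E 0).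
Definition colim_one : colim := colim_in (1 : E 0).

Lemma colim_addE n (a b : E n) : colim_add (colim_in a) (colim_in b) = colim_in (a + b).
Proof. by apply: colim_op2E => {}n m {}a {}b lenm; rewrite pushD. Qed.
Lemma colim_mulE n (a b : E n) : colim_mul (colim_in a) (colim_in b) = colim_in (a * b).
Proof. by apply: colim_op2E => {}n m {}a {}b lenm; rewrite pushM. Qed.
Lemma colim_oppE n (a : E n) : colim_opp (colim_in a) = colim_in (- a).
Proof. by apply: colim_op1E => {}n m {}a lenm; rewrite pushN. Qed.
Lemma colim_scaleE c n (a : E n) : colim_scale c (colim_in a) = colim_in (c *: a).
Proof. by apply: colim_op1E => {}n m {}a lenm; rewrite pushZ. Qed.
Lemma colim_in0 n : colim_in (0 : E n) = colim_zero.
Proof. by rewrite /colim_zero -(colim_in_push (0 : E 0) (leq0n n)) push0. Qed.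
Lemma colim_in1 n : colim_in (1 : E n) = colim_one.
Proof. by rewrite /colim_one -(colim_in_push (1 : E 0) (leq0n n)) push1. Qed.

Lemma colim_lift2 (z w : colim) : exists n (a b : E n), z = colim_in a /\ w = colim_in b.
Proof.
have [n [a ->]] := colim_lift z; have [m [b ->]] := colim_lift w.
exists (maxn n m), (push _ a), (push _ b).
by rewrite !colim_in_push ?leq_maxl ?leq_maxr.
Qed.

Lemma colim_lift3 (z w t : colim) : exists n (a b c : E n),
  [/\ z = colim_in a, w = colim_in b & t = colim_in c].
Proof.
have [n [a [b [-> ->]]]] := colim_lift2 z w; have [m [c ->]] := colim_lift t.
exists (maxn n m), (push _ a), (push _ b), (push _ c).
by rewrite !colim_in_push ?leq_maxl ?leq_maxr.
Qed.

Fact colim_addA : associative colim_add.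
Proof.
move=> z w t; have [n [a [b [c [-> -> ->]]]]] := colim_lift3 z w t.
by rewrite !colim_addE addrA.
Qed.
Fact colim_addC : commutative colim_add.
Proof.
move=> z w; have [n [a [b [-> ->]]]] := colim_lift2 z w.
by rewrite !colim_addE addrC.
Qed.
Fact colim_add0 : left_id colim_zero colim_add.
Proof.
by move=> z; have [n [a ->]] := colim_lift z; rewrite -(colim_in0 n) colim_addE add0r.
Qed.
Fact colim_addN : left_inverse colim_zero colim_opp colim_add.
Proof.
move=> z; have [n [a ->]] := colim_lift z.
by rewrite colim_oppE colim_addE addNr colim_in0.
Qed.

HB.instance Definition _ :=
  GRing.isZmodule.Build colim colim_addA colim_addC colim_add0 colim_addN.

Lemma colim_inD n (a b : E n) : colim_in (a + b) = colim_in a + colim_in b.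
Proof. by rewrite -colim_addE. Qed.

Fact colim_mulA : associative colim_mul.
Proof.
move=> z w t; have [n [a [b [c [-> -> ->]]]]] := colim_lift3 z w t.
by rewrite !colim_mulE mulrA.
Qed.
Fact colim_mul1 : left_id colim_one colim_mul.
Proof.
by move=> z; have [n [a ->]] := colim_lift z; rewrite -(colim_in1 n) colim_mulE mul1r.
Qed.
Fact colim_mulr1 : right_id colim_one colim_mul.
Proof.
by move=> z; have [n [a ->]] := colim_lift z; rewrite -(colim_in1 n) colim_mulE mulr1.
Qed.
Fact colim_mulDl : left_distributive colim_mul colim_add.
Proof.
move=> z w t; have [n [a [b [c [-> -> ->]]]]] := colim_lift3 z w t.
by rewrite !(colim_addE, colim_mulE) mulrDl.
Qed.
Fact colim_mulDr : right_distributive colim_mul colim_add.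
Proof.
move=> z w t; have [n [a [b [c [-> -> ->]]]]] := colim_lift3 z w t.
by rewrite !(colim_addE, colim_mulE) mulrDr.
Qed.
Fact colim_one_neq0 : colim_one != 0.
Proof.
apply/eqP => /colim_inP[N [_ _]]; rewrite push0 // push1 // => /eqP.
by rewrite oner_eq0.
Qed.

HB.instance Definition _ := GRing.Zmodule_isNzRing.Build colim
  colim_mulA colim_mul1 colim_mulr1 colim_mulDl colim_mulDr colim_one_neq0.

Lemma colim_inM n (a b : E n) : colim_in (a * b) = colim_in a * colim_in b.
Proof. by rewrite -colim_mulE. Qed.

Fact colim_scaleA c d z : colim_scale c (colim_scale d z) = colim_scale (c * d) z.
Proof. by have [n [a ->]] := colim_lift z; rewrite !colim_scaleE scalerA. Qed.
Fact colim_scale1 : left_id 1 colim_scale.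
Proof. by move=> z; have [n [a ->]] := colim_lift z; rewrite colim_scaleE scale1r. Qed.
Fact colim_scaleDr : right_distributive colim_scale +%R.
Proof.
move=> c z w; have [n [a [b [-> ->]]]] := colim_lift2 z w.
by rewrite -colim_inD !colim_scaleE scalerDr colim_inD.
Qed.
Fact colim_scaleDl z : {morph colim_scale^~ z : c d / c + d}.
Proof.
move=> c d; have [n [a ->]] := colim_lift z.
by rewrite !colim_scaleE scalerDl colim_inD.
Qed.

HB.instance Definition _ := GRing.Zmodule_isLmodule.Build k colim
  colim_scaleA colim_scale1 colim_scaleDr colim_scaleDl.

Lemma colim_inZ c n (a : E n) : colim_in (c *: a) = c *: colim_in a.
Proof. by rewrite -colim_scaleE. Qed.

Fact colim_scaleAl c (z w : colim) : c *: (z * w) = c *: z * w.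
Proof.
have [n [a [b [-> ->]]]] := colim_lift2 z w.
by rewrite -!(colim_inM, colim_inZ) scalerAl.
Qed.
HB.instance Definition _ := GRing.Lmodule_isLalgebra.Build k colim colim_scaleAl.

Fact colim_scaleAr c (z w : colim) : c *: (z * w) = z * (c *: w).
Proof.
have [n [a [b [-> ->]]]] := colim_lift2 z w.
by rewrite -!(colim_inM, colim_inZ) scalerAr.
Qed.
HB.instance Definition _ := GRing.Lalgebra_isAlgebra.Build k colim colim_scaleAr.

Definition colim_comp (i : I) (z : colim) : Prop :=
  exists n (a : E n), gr_comp i a /\ z = colim_in a.

Lemma colim_in_sum n (T : Type) (s : seq T) (F : T -> E n) :
  colim_in (\sum_(i <- s) F i) = \sum_(i <- s) colim_in (F i).
Proof. exact: (big_morph (@colim_in n) (@colim_inD n) (@colim_in0 n)). Qed.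

Fact colim_grading : is_grading colim_comp.
Proof.
split.
- by move=> i; exists 0%N, 0; split=> //; apply: grading_submod0 (gr_ax _) _.
- move=> i c z w [n [a [ai ->]]] [m [b [bi ->]]].
  have [nN mN] := (leq_maxl n m, leq_maxr n m).
  exists (maxn n m), (c *: push _ a + push _ b); split.
    by apply: (grading_linear (gr_ax _)); apply: push_comp.
  by rewrite colim_inD colim_inZ !colim_in_push.
- by exists 0%N, 1; split=> //; apply: grading_one (gr_ax _).
- move=> i j z w [n [a [ai ->]]] [m [b [bj ->]]].
  have [nN mN] := (leq_maxl n m, leq_maxr n m).
  exists (maxn n m), (push _ a * push _ b); split.
    by apply: (grading_mul (gr_ax _)); apply: push_comp.
  by rewrite colim_inM !colim_in_push.
- move=> z; have [n [a ->]] := colim_lift z.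
  have [s [sP ->]] := grading_span (gr_ax (E n)) a.
  exists (map (@colim_in n) s); split; last by rewrite colim_in_sum big_map.
  by move=> w /mapP[y /sP[i yi] ->]; exists i, n, y.
- move=> s c us sP sc0.
  have [N [c' c'P]]: exists N (c' : I -> E N),
      forall i, i \in s -> gr_comp i (c' i) /\ c i = colim_in (c' i).
    elim: s sP {us sc0} => [|j s IH] sP; first by exists 0%N, (fun=> 0).
    have [i is_|N [c' c'P]] := IH _; first by apply: sP; rewrite inE is_ orbT.
    have [|m [b [bj cj]]] := sP j; first by rewrite inE eqxx.
    have [NK mK] := (leq_maxl N m, leq_maxr N m).
    exists (maxn N m), (fun i => if i == j then push _ b else push _ (c' i)).
    move=> i; rewrite inE; case: eqP => [-> _|_ /= /c'P[ci' ->]].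
      by split; [apply: push_comp | rewrite colim_in_push].
    by split; [apply: push_comp | rewrite colim_in_push].
  have: colim_in (\sum_(i <- s) c' i) = colim_in (0 : E N).
    rewrite colim_in0 colim_in_sum -[RHS]sc0 big_seq [RHS]big_seq.
    by apply: eq_bigr => i /c'P[_ ->].
  move=> /colim_inP[M [NM _]]; rewrite push0 // push_sum // => sc'0 i is_.
  have [_ ->] := c'P i is_; rewrite -(colim_in_push _ NM).
  rewrite (grading_direct (gr_ax (E M)) us _ sc'0 is_) ?colim_in0 // => j js.
  by apply: push_comp => //; have [] := c'P j js.
Qed.

Definition ColimGr : gralg k I := GrAlg colim_grading.
End Colim.

(* The exterior algebra A[xi_1, ..., xi_n] over a commutative ring A:
   f stands for the sum of the f S * xi_S, where xi_S is the product of the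
   xi_i, i in S, in increasing order.  For disjoint S and T,
   xi_S * xi_T = (-1) ^ (ext_inv S T) xi_(S :|: T). *)
Definition extalg (A : Type) (n : nat) := {ffun {set 'I_n} -> A}.

Definition ext_inv (n : nat) (S T : {set 'I_n}) : nat :=
  (\sum_(i in S) \sum_(j in T) (j < i))%N.

HB.instance Definition _ (A : zmodType) n :=
  GRing.Zmodule.copy (extalg A n) {ffun {set 'I_n} -> A}.

Section ExtRing.
Variables (A : comNzRingType) (n : nat).
Implicit Types (f g h : extalg A n) (S T U : {set 'I_n}).

Definition ext_one : extalg A n := [ffun S : {set 'I_n} => (S == set0)%:R].

Definition ext_mul f g : extalg A n :=
  [ffun S : {set 'I_n} => \sum_(T : {set 'I_n} | T \subset S)
     (-1) ^+ ext_inv T (S :\: T) * (f T * g (S :\: T))].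

Lemma ext_inv0l S : ext_inv set0 S = 0%N.
Proof. exact: big_set0. Qed.

Lemma ext_inv0r S : ext_inv S set0 = 0%N.
Proof. by apply: big1 => i _; apply: big_set0. Qed.

Let sum_setU S T (F : 'I_n -> nat) : [disjoint S & T] ->
  (\sum_(i in S :|: T) F i = \sum_(i in S) F i + \sum_(i in T) F i)%N.
Proof.
move=> ST; rewrite -bigU //; apply: eq_bigl => i.
by rewrite !inE.
Qed.

Lemma ext_invUl S T U : [disjoint S & T] ->
  ext_inv (S :|: T) U = (ext_inv S U + ext_inv T U)%N.
Proof. exact: sum_setU. Qed.

Lemma ext_invUr S T U : [disjoint S & T] ->
  ext_inv U (S :|: T) = (ext_inv U S + ext_inv U T)%N.
Proof.
move=> ST; rewrite /ext_inv -big_split; apply: eq_bigr => i _.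
exact: sum_setU.
Qed.

Let setUDid S T : T \subset S -> S = T :|: S :\: T.
Proof. by move/setIidPr=> {1}<-; rewrite setID. Qed.

Let disjointD S T : [disjoint T & S :\: T].
Proof. by apply/pred0P => x; rewrite /= !inE; case: (x \in T). Qed.

Fact ext_mulA : associative ext_mul.
Proof.
move=> f g h; apply/ffunP => S; rewrite !ffunE.
pose F U V : A := (-1) ^+ (ext_inv U V + ext_inv U (S :\: (U :|: V))
                   + ext_inv V (S :\: (U :|: V)))
          * (f U * (g V * h (S :\: (U :|: V)))).
transitivity (\sum_(U : {set 'I_n} | U \subset S)
    \sum_(V : {set 'I_n} | V \subset S :\: U) F U V).
  apply: eq_bigr => U US; rewrite ffunE !mulr_sumr.
  apply: eq_bigr => V VSU.
  rewrite {1}(setUDid VSU) ext_invUr ?disjointD // setDDl /F !exprD.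
  ring.
transitivity (\sum_(T : {set 'I_n} | T \subset S)
    \sum_(U : {set 'I_n} | U \subset T) F U (T :\: U)); last first.
  apply: eq_bigr => T TS; rewrite ffunE mulr_suml mulr_sumr.
  apply: eq_bigr => U UT; rewrite /F -(setUDid UT).
  have -> : ext_inv T (S :\: T) = (ext_inv U (S :\: T) + ext_inv (T :\: U) (S :\: T))%N.
    by rewrite {1}(setUDid UT) ext_invUl ?disjointD.
  rewrite !exprD.
  ring.
rewrite [RHS](exchange_big_dep (fun U : {set 'I_n} => U \subset S)) /=; last first.
  by move=> T U TS UT; apply: subset_trans TS.
apply: eq_bigr => U US.
rewrite (reindex_onto (fun T => T :\: U) (fun V => U :|: V)) /=; last first.
  move=> V; rewrite subsetD => /andP[_ VU].
  by rewrite setDUl setDv set0U; apply/setDidPl.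
apply: eq_bigl => T; apply/andP/andP => [[TSU /eqP TE]|[TS UT]].
  split; last by rewrite -TE subsetUl.
  rewrite -TE subUset US; exact: subset_trans TSU (subsetDl _ _).
by rewrite setSD // -setUDid // eqxx.
Qed.

Fact ext_mul1 : left_id ext_one ext_mul.
Proof.
move=> f; apply/ffunP => S; rewrite ffunE (bigD1 set0) ?sub0set //= big1.
  by rewrite ext_inv0l setD0 ffunE eqxx !mul1r addr0.
by move=> T /andP[_ /negbTE T0]; rewrite ffunE T0 mul0r mulr0.
Qed.

Fact ext_mulr1 : right_id ext_one ext_mul.
Proof.
move=> f; apply/ffunP => S; rewrite ffunE (bigD1 S) //= big1.
  by rewrite setDv ext_inv0r ffunE eqxx mul1r mulr1 addr0.
move=> T /andP[TS nTS]; rewrite ffunE setD_eq0.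
case ST: (S \subset T); last by rewrite !mulr0.
by move: nTS; rewrite eqEsubset TS ST.
Qed.

Fact ext_mulDl : left_distributive ext_mul +%R.
Proof.
move=> f g h; apply/ffunP => S; rewrite !ffunE -big_split.
by apply: eq_bigr => T _; rewrite ffunE mulrDl mulrDr.
Qed.

Fact ext_mulDr : right_distributive ext_mul +%R.
Proof.
move=> f g h; apply/ffunP => S; rewrite !ffunE -big_split.
by apply: eq_bigr => T _; rewrite ffunE !mulrDr.
Qed.

Fact ext_one_neq0 : ext_one != 0.
Proof.
apply/eqP => /ffunP/(_ set0)/eqP; rewrite !ffunE eqxx; exact/negP/oner_neq0.
Qed.

HB.instance Definition _ := GRing.Zmodule_isNzRing.Build (extalg A n)
  ext_mulA ext_mul1 ext_mulr1 ext_mulDl ext_mulDr ext_one_neq0.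
End ExtRing.

Section ExtAlgebra.
Variables (k : fieldType) (A : comAlgType k) (n : nat).

HB.instance Definition _ :=
  GRing.Lmodule.copy (extalg A n) {ffun {set 'I_n} -> A}.

Fact ext_scaleAl (c : k) (f g : extalg A n) : c *: (f * g) = c *: f * g.
Proof.
apply/ffunP => S; rewrite !ffunE scaler_sumr; apply: eq_bigr => T _.
by rewrite ffunE -scalerAl -scalerAr.
Qed.
HB.instance Definition _ :=
  GRing.Lmodule_isLalgebra.Build k (extalg A n) ext_scaleAl.

Fact ext_scaleAr (c : k) (f g : extalg A n) : c *: (f * g) = f * (c *: g).
Proof.
apply/ffunP => S; rewrite !ffunE scaler_sumr; apply: eq_bigr => T _.
by rewrite ffunE -!scalerAr.
Qed.
HB.instance Definition _ :=
  GRing.Lalgebra_isAlgebra.Build k (extalg A n) ext_scaleAr.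
End ExtAlgebra.

(* The algebras R(n, p).  The generator of index i : 'I_n is x_(i+1), resp.
   xi_(i+1). *)

Definition deg_x_even (i : nat) : rat := (2 ^+ i - 1) / 2 ^+ i.
Definition deg_x_odd (p i : nat) : rat :=
  2 * (p%:R ^+ i - 1) / p%:R ^+ i.
Definition deg_xi_odd (p i : nat) : rat := (p%:R ^+ i - 2) / p%:R ^+ i.

Lemma hom_span_sum (k : fieldType) (A : algType k) (I : Type) (H : I -> A -> Prop)
    (T : Type) (r : seq T) (F : T -> A) :
  (forall t, exists s : seq A,
    (forall y, y \in s -> exists i, H i y) /\ F t = \sum_(y <- s) y) ->
  exists s : seq A,
    (forall y, y \in s -> exists i, H i y) /\ \sum_(t <- r) F t = \sum_(y <- s) y.
Proof.
move=> FP; elim: r => [|t r [s [sP sE]]]; first by exists [::]; rewrite !big_nil.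
have [s' [s'P s'E]] := FP t; exists (s' ++ s).
rewrite big_cons big_cat s'E sE; split=> // y.
by rewrite mem_cat => /orP[/s'P|/sP].
Qed.

Section PolyGrading.
Variables (k : fieldType) (w : nat -> rat).

Definition mnm_deg (n : nat) (m : 'X_{1..n}) : rat :=
  \sum_(i < n) (m i)%:R * w i.+1.

Definition poly_comp (n : nat) (d : rat) (P : {mpoly k[n]}) : Prop :=
  forall m, m \in msupp P -> mnm_deg m = d.

Lemma mnm_degD n (m m' : 'X_{1..n}) :
  mnm_deg (m + m')%MM = mnm_deg m + mnm_deg m'.
Proof.
rewrite /mnm_deg -big_split; apply: eq_bigr => i _.
by rewrite mnmDE natrD mulrDl.
Qed.

Lemma poly_comp0 n d : poly_comp d (0 : {mpoly k[n]}).
Proof. by move=> m; rewrite msupp0. Qed.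

Lemma poly_comp_lin n d a (P Q : {mpoly k[n]}) :
  poly_comp d P -> poly_comp d Q -> poly_comp d (a *: P + Q).
Proof.
move=> HP HQ m; rewrite mcoeff_msupp mcoeffD mcoeffZ.
case P0: (m \in msupp P); first by move=> _; exact: HP.
case Q0: (m \in msupp Q); first by move=> _; exact: HQ.
by rewrite (memN_msupp_eq0 (negbT P0)) (memN_msupp_eq0 (negbT Q0)) mulr0 addr0 eqxx.
Qed.

Lemma poly_compD n d (P Q : {mpoly k[n]}) :
  poly_comp d P -> poly_comp d Q -> poly_comp d (P + Q).
Proof. by move=> HP HQ; rewrite -[P]scale1r; apply: poly_comp_lin. Qed.

Lemma poly_compZ n d a (P : {mpoly k[n]}) : poly_comp d P -> poly_comp d (a *: P).
Proof.
by move=> HP; rewrite -[a *: P]addr0; apply: poly_comp_lin => //; exact: poly_comp0.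
Qed.

Lemma poly_comp_sum n d (T : Type) (r : seq T) (Q : pred T) (F : T -> {mpoly k[n]}) :
  (forall t, Q t -> poly_comp d (F t)) -> poly_comp d (\sum_(t <- r | Q t) F t).
Proof.
by move=> FP; elim/big_ind: _ => //; [exact: poly_comp0 | move=> *; exact: poly_compD].
Qed.

Lemma poly_comp1 n : poly_comp 0 (1 : {mpoly k[n]}).
Proof.
move=> m; rewrite msupp1 inE => /eqP ->; apply: big1 => i _.
by rewrite mnm0E mul0r.
Qed.

Lemma poly_compM n d e (P Q : {mpoly k[n]}) :
  poly_comp d P -> poly_comp e Q -> poly_comp (d + e) (P * Q).
Proof.
move=> HP HQ m /msuppM_le/allpairsP[[m1 m2] /= [m1P m2Q ->]].
by rewrite mnm_degD HP ?HQ.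
Qed.

Lemma poly_compX n (m : 'X_{1..n}) : poly_comp (mnm_deg m) ('X_[m] : {mpoly k[n]}).
Proof. by move=> m'; rewrite msuppX inE => /eqP ->. Qed.

Lemma poly_comp_direct n (s : seq rat) (c : rat -> {mpoly k[n]}) : uniq s ->
  (forall i, i \in s -> poly_comp i (c i)) -> \sum_(i <- s) c i = 0 ->
  forall i, i \in s -> c i = 0.
Proof.
move=> us sP sc0 i is_; apply/mpolyP => m; rewrite mcoeff0.
case mi: (m \in msupp (c i)); last by rewrite (memN_msupp_eq0 (negbT mi)).
have := congr1 (mcoeff m) sc0; rewrite raddf_sum mcoeff0 /= (bigD1_seq i) //=.
rewrite big_seq_cond big1 ?addr0 // => j /andP[js ji].
apply: memN_msupp_eq0; apply: contra ji => mj.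
by rewrite -(sP j js m mj) (sP i is_ m mi).
Qed.

Fact poly_grading n : is_grading (@poly_comp n).
Proof.
split.
- exact: poly_comp0.
- exact: poly_comp_lin.
- exact: poly_comp1.
- exact: poly_compM.
- move=> P; rewrite [P]mpolyE; apply: hom_span_sum => m.
  exists [:: P@_m *: 'X_[m]]; rewrite big_seq1; split=> // y.
  rewrite inE => /eqP ->; exists (mnm_deg m).
  exact/poly_compZ/poly_compX.
- exact: poly_comp_direct.
Qed.

Lemma mnm_deg_widen n (m : 'X_{1..n}) : mnm_deg (mnmwiden m) = mnm_deg m.
Proof.
rewrite /mnm_deg big_ord_recr /= mnmwiden_ordmax mul0r addr0.
by apply: eq_bigr => i _; rewrite mnmwiden_widen.
Qed.

Lemma poly_comp_widen n d (P : {mpoly k[n]}) :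
  poly_comp d P -> poly_comp d (mwiden P).
Proof.
move=> HP; rewrite [P]mpolyE raddf_sum big_seq; apply: poly_comp_sum => m mP.
rewrite /= mwidenZ mwidenX; apply: poly_compZ.
by rewrite -(HP m mP) -mnm_deg_widen; exact: poly_compX.
Qed.
End PolyGrading.

HB.instance Definition _ (k : fieldType) n :=
  GRing.isScalable.Build k {mpoly k[n]} {mpoly k[n.+1]} *:%R
    (@mwiden n k) (@mwidenZ n k).

(* R(n, 2) = k[x_1, ..., x_n] *)
Section REven.
Variable k : fieldType.
Definition R_even (n : nat) : gralg k rat :=
  GrAlg (@poly_grading k deg_x_even n).

Definition R_even_incl (n : nat) : grmor (R_even n) (R_even n.+1) :=
  @GrMor k rat (R_even n) (R_even n.+1)
    (@mwiden n k) (@poly_comp_widen k deg_x_even n).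
End REven.

(* R(n, p) = k[x_1, ..., x_n] (x) Lambda(xi_1, ..., xi_n), p odd *)
Section ROdd.
Variables (k : fieldType) (p : nat).

Definition xi_deg (n : nat) (S : {set 'I_n}) : rat :=
  \sum_(i in S) deg_xi_odd p i.+1.

Definition ext_comp (n : nat) (d : rat) (f : extalg {mpoly k[n]} n) : Prop :=
  forall S m, m \in msupp (f S) -> mnm_deg (deg_x_odd p) m + xi_deg S = d.

Lemma ext_compP n d (f : extalg {mpoly k[n]} n) : ext_comp d f <->
  forall S, poly_comp (deg_x_odd p) (d - xi_deg S) (f S).
Proof.
split=> fP S m /fP => [<-|->]; first by rewrite addrK.
by rewrite subrK.
Qed.

Lemma xi_deg_sub n (S T : {set 'I_n}) : T \subset S ->
  xi_deg S = xi_deg T + xi_deg (S :\: T).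
Proof. by move=> TS; rewrite /xi_deg (big_setID T) /= (setIidPr TS). Qed.

Fact ext_grading n : is_grading (@ext_comp n).
Proof.
split.
- by move=> d S m; rewrite ffunE msupp0.
- move=> d a f g /ext_compP fP /ext_compP gP; apply/ext_compP => S.
  by rewrite !ffunE; apply: poly_comp_lin.
- apply/ext_compP => S; rewrite ffunE; case: eqP => [->|_].
    by rewrite /xi_deg big_set0 subr0; exact: poly_comp1.
  exact: poly_comp0.
- move=> d e f g /ext_compP fP /ext_compP gP; apply/ext_compP => S.
  rewrite ffunE; apply: poly_comp_sum => T TS.
  rewrite -signr_odd mulr_sign -scaler_sign; apply: poly_compZ.
  have -> : d + e - xi_deg S = (d - xi_deg T) + (e - xi_deg (S :\: T)).
    by rewrite (xi_deg_sub TS); ring.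
  exact: poly_compM.
- move=> f.
  pose D S (m : 'X_{1..n}) : extalg {mpoly k[n]} n :=
    [ffun T : {set 'I_n} => if T == S then (f S)@_m *: 'X_[m] else 0].
  have -> : f = \sum_(S : {set 'I_n}) \sum_(m <- msupp (f S)) D S m.
    apply/ffunP => T; rewrite sum_ffunE (bigD1 T) //= [X in _ + X]big1 ?addr0.
      rewrite sum_ffunE {1}[f T]mpolyE; apply: eq_bigr => m _.
      by rewrite ffunE eqxx.
    move=> S /negbTE ST; rewrite sum_ffunE big1 // => m _.
    by rewrite ffunE eq_sym ST.
  apply: hom_span_sum => S; apply: hom_span_sum => m.
  exists [:: D S m]; rewrite big_seq1; split=> // y; rewrite inE => /eqP ->.
  exists (mnm_deg (deg_x_odd p) m + xi_deg S); apply/ext_compP => T.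
  rewrite ffunE; case: eqP => [->|_]; last exact: poly_comp0.
  by rewrite addrK; apply/poly_compZ/poly_compX.
- move=> s c us sP sc0 i is_; apply/ffunP => S; rewrite ffunE.
  pose c' j := c (j + xi_deg S) S.
  have c'E j : c j S = c' (j - xi_deg S) by rewrite /c' subrK.
  rewrite c'E.
  apply: (@poly_comp_direct k (deg_x_odd p) n [seq j - xi_deg S | j <- s] c').
  + by rewrite map_inj_uniq //; exact: addIr.
  + by move=> _ /mapP[j js ->]; rewrite -c'E; move/ext_compP: (sP j js); apply.
  + rewrite big_map; move/ffunP/(_ S): sc0; rewrite sum_ffunE ffunE => sc0.
    by rewrite -[RHS]sc0; apply: eq_bigr => j _; rewrite c'E.
  + exact: map_f.
Qed.

Definition R_odd (n : nat) : gralg k rat := GrAlg (@ext_grading n).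

Definition wid n : 'I_n -> 'I_n.+1 := widen_ord (leqnSn n).

(* x_i |-> x_i and xi_i |-> xi_i; xi_S is outside the image when S contains
   the new index. *)
Definition ext_widen n (f : R_odd n) : R_odd n.+1 :=
  [ffun S : {set 'I_n.+1} =>
     if ord_max \in S then 0 else mwiden (f (@wid n @^-1: S))].

Lemma wid_inj n : injective (@wid n).
Proof. by move=> i j /(congr1 val)/= /val_inj. Qed.

Lemma wid_max n (i : 'I_n) : wid i != ord_max.
Proof. by rewrite -val_eqE /= neq_ltn ltn_ord. Qed.

Lemma wid_preimK n (S : {set 'I_n.+1}) : ord_max \notin S ->
  @wid n @: (@wid n @^-1: S) = S.
Proof.
move=> maxS; apply/setP => i; apply/imsetP/idP => [[j]|iS].
  by rewrite inE => jS ->.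
have lti : (i < n)%N.
  rewrite ltn_neqAle -ltnS ltn_ord andbT; apply: contra maxS => /eqP iE.
  by have <- : i = ord_max by apply/val_inj.
have iE : i = wid (Ordinal lti) by apply/val_inj.
by exists (Ordinal lti); rewrite // inE -iE.
Qed.

Lemma wid_imK n (S : {set 'I_n}) : @wid n @^-1: (@wid n @: S) = S.
Proof. by apply/setP => i; rewrite inE mem_imset //; exact: wid_inj. Qed.

Lemma wid_im_max n (S : {set 'I_n}) : ord_max \notin @wid n @: S.
Proof. by apply/imsetP => -[i _ /eqP]; rewrite eq_sym (negbTE (wid_max i)). Qed.

Lemma ext_inv_wid n (S T : {set 'I_n}) :
  ext_inv (@wid n @: S) (@wid n @: T) = ext_inv S T.
Proof.
have injw : injective (@wid n) := @wid_inj n.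
rewrite /ext_inv big_imset /=; last by move=> ? ? _ _; exact: injw.
by apply: eq_bigr => i _; rewrite big_imset //= => ? ? _ _; exact: injw.
Qed.

Lemma ext_widenE n (f : R_odd n) (S : {set 'I_n}) : ext_widen f (@wid n @: S) = mwiden (f S).
Proof. by rewrite ffunE (negbTE (wid_im_max S)) wid_imK. Qed.

Lemma ext_widen_max n (f : R_odd n) (S : {set 'I_n.+1}) : ord_max \in S -> ext_widen f S = 0.
Proof. by rewrite ffunE => ->. Qed.

Fact ext_widen_zmod n : zmod_morphism (@ext_widen n).
Proof.
move=> f g; apply/ffunP => S; rewrite !ffunE.
by case: ifP => _; rewrite ?subr0 // raddfB.
Qed.

Fact ext_widen_scalable n : scalable (@ext_widen n).
Proof.
move=> a f; apply/ffunP => S; rewrite !ffunE.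
by case: ifP => _; rewrite ?scaler0 // mwidenZ.
Qed.

Fact ext_widen_monoid n : monoid_morphism (@ext_widen n).
Proof.
split=> [|f g]; apply/ffunP => S.
  have [maxS|maxS] := boolP (ord_max \in S).
    rewrite ext_widen_max // ffunE; case: eqP => // S0.
    by move: maxS; rewrite S0 inE.
  rewrite -(wid_preimK maxS) ext_widenE !ffunE imset_eq0.
  by case: eqP => _; rewrite ?mwiden1 ?mwiden0.
have [maxS|maxS] := boolP (ord_max \in S).
  rewrite ext_widen_max // [RHS]ffunE big1 // => T TS.
  have [maxT|maxT] := boolP (ord_max \in T).
    by rewrite (ext_widen_max f maxT) mul0r mulr0.
  by rewrite (@ext_widen_max _ g) ?mulr0 // inE maxT.
rewrite -(wid_preimK maxS); move: (_ @^-1: _) => {maxS}S.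
rewrite ext_widenE [in LHS]ffunE [RHS]ffunE raddf_sum /=.
rewrite [RHS](reindex_onto (fun T : {set 'I_n} => @wid n @: T)
                           (fun T : {set 'I_n.+1} => @wid n @^-1: T)) /=.
  apply: eq_big => T.
    rewrite wid_imK eqxx andbT; apply/idP/idP => [TS|]; first exact: imsetS.
    by move/(preimsetS (@wid n)); rewrite !wid_imK.
  move=> TS.
  have -> : @wid n @: S :\: @wid n @: T = @wid n @: (S :\: T).
    rewrite -[LHS]wid_preimK; first by rewrite preimsetD !wid_imK.
    by apply: contra (wid_im_max S); rewrite inE => /andP[].
  by rewrite ext_inv_wid !ext_widenE rmorphM rmorphXn rmorphN1 rmorphM.
move=> T TS; apply: wid_preimK; apply: contra (wid_im_max S).
exact: (subsetP TS).
Qed.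

HB.instance Definition _ n :=
  GRing.isZmodMorphism.Build (R_odd n) (R_odd n.+1) (@ext_widen n)
    (@ext_widen_zmod n).
HB.instance Definition _ n :=
  GRing.isMonoidMorphism.Build (R_odd n) (R_odd n.+1) (@ext_widen n)
    (@ext_widen_monoid n).
HB.instance Definition _ n :=
  GRing.isScalable.Build k (R_odd n) (R_odd n.+1) *:%R (@ext_widen n)
    (@ext_widen_scalable n).

Fact ext_widen_comp n d (f : R_odd n) : gr_comp d f -> gr_comp d (ext_widen f).
Proof.
move=> /ext_compP fP; apply/ext_compP => S.
have [maxS|maxS] := boolP (ord_max \in S).
  by rewrite ext_widen_max //; exact: poly_comp0.
rewrite -(wid_preimK maxS) ext_widenE; move: (_ @^-1: _) => {maxS}S.
have -> : xi_deg (@wid n @: S) = xi_deg S.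
  by rewrite /xi_deg big_imset //= => ? ? _ _; exact: wid_inj.
exact: poly_comp_widen.
Qed.

Definition R_odd_incl (n : nat) : grmor (R_odd n) (R_odd n.+1) :=
  @GrMor k rat (R_odd n) (R_odd n.+1) (@ext_widen n) (@ext_widen_comp n).
End ROdd.

Record grsys (k : fieldType) := GrSys {
  sys_obj : nat -> gralg k rat;
  sys_map : forall n, grmor (sys_obj n) (sys_obj n.+1)
}.

Definition R_sys (k : fieldType) (p : nat) : grsys k :=
  if p == 2 then GrSys (R_even_incl k) else GrSys (R_odd_incl k p).

Definition E_alg (k : fieldType) (p n : nat) : gralg k int :=
  IntGr (sys_obj (R_sys k p) n).

Definition E_incl (k : fieldType) (p n : nat) :
    grmor (E_alg k p n) (E_alg k p n.+1) :=
  IntGr_map (sys_map (R_sys k p) n).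

Definition E_infty (k : fieldType) (p : nat) : gralg k int :=
  ColimGr (E_incl k p).

Definition has_dim (k : fieldType) (V : lmodType k) (U : V -> Prop) (D : nat) :
    Prop :=
  exists b : 'I_D -> V,
    [/\ forall i, U (b i),
        forall c : 'I_D -> k,
          \sum_(i < D) c i *: b i = 0 -> forall i, c i = 0
      & forall v, U v -> exists c : 'I_D -> k, v = \sum_(i < D) c i *: b i].

Definition ell (p i : nat) : fps int :=
  let q := fps_X int in
  if p == 2 then
    \prod_(1 <= j < i.+1) (q ^+ (2 ^ j - 1)%N / (1 - q ^+ (2 ^ j - 1)%N))
  else
    \prod_(1 <= j < i.+1)
      ((q ^+ (2 * p ^ (j - 1) * (p - 1) - 1)%N + q ^+ (2 * (p ^ j - 1))%N)
         / (1 - q ^+ (2 * (p ^ j - 1))%N)).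

Lemma fps_geom_unit (c : nat) :
  (0 < c)%N -> (1 - fps_X int ^+ c) \is a GRing.unit.
Proof.
case: c => // c _; rewrite exprS /GRing.unit /=.
by rewrite /in_mem /= /fps_unit /= big_ord1 mul0r subr0.
Qed.

(* sum_i (-1)^i t^i ell_(i,p)(q), in Z[[q]][[t]] *)
Definition N_denom (p : nat) : fps (fps int) :=
  Fps (fun i => (-1) ^+ i * ell p i).

Lemma N_denom_unit (p : nat) : N_denom p \is a GRing.unit.
Proof.
rewrite /GRing.unit /= /in_mem /= /fps_unit /= expr0 mul1r /ell !big_nil.
by case: (p == 2); rewrite unitr1.
Qed.

(* N_p(m, d), the coefficient of t^m q^d. *)
Definition N_coef (p m d : nat) : int := (N_denom p)^-1 m d.

(* The partial sums of u converge to s in the discrete group Z. *)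
Definition int_series_sum (u : nat -> int) (s : int) : Prop :=
  exists M : nat, forall K : nat, (M <= K)%N -> \sum_(m < K) u m = s.

(* Main.v *)
Require Import Defs.
From mathcomp Require Import all_boot all_order all_algebra.
From mathcomp Require Import ring zify mpoly.
Import GRing.Theory Num.Theory.
Local Open Scope ring_scope.

Set Implicit Arguments.
Unset Strict Implicit.
Unset Printing Implicit Defensive.

(* The monomials [x^a xi^e] form a basis of R(n, p).  Put E = 1 if p = 2 and
   E = 2 if p is odd, so that 0 <= e_i < E.  The degree of [x^a xi^e] is an
   integer iff sum_i (a_i + e_i) / p^i is, iff there are natural numbers b_i
   with b_{n+1} = 0 and a_i + e_i = p b_i - b_{i+1}; the degree is then
   sum_i (E (p - 1) b_i - e_i).  Dropping the zero b_i, which form a tail, one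
   has to count the words in letters (b, e), b > 0, without an "overshoot"
   b_{i+1} > p b_i - e_i between consecutive letters.  The words in which every
   step is an overshoot have generating function ell_i (substitute
   b_{i+1} = p b_i - e_i + c_{i+1} with c_{i+1} > 0), and splitting a word into
   an overshooting prefix and an overshoot-free suffix yields a telescoping
   alternating sum, i.e. the generating function of the overshoot-free words is
   the inverse of sum_i (-1)^i t^i ell_i.  To keep all sums finite, letters are
   restricted to b <= K and power series are compared up to q^K. *)

(** * Alternating sums over the cuts of a word *)

Section AlternatingRuns.
Variables (R : comPzRingType) (T : Type) (e : rel T).

(** For a nonempty word with first letter [z], the cut before [z] tests whether the word is free of
    links; by induction the other cuts together subtract the same number times [e y z]. *)
Lemma alternating_path (y : T) (w : seq T) :
  \sum_(i < (size w).+1)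
     (-1) ^+ i * (path e y (take i w) && sorted (fun a b => ~~ e a b) (drop i w))%:R
  = (path (fun a b => ~~ e a b) y w)%:R :> R.
Proof.
elim: w y => [|z w IH] y; first by rewrite big_ord1 mul1r.
rewrite big_ord_recl /= expr0 mul1r.
under eq_bigr => i _ do rewrite /bump leq0n add1n exprS mulN1r mulNr -andbA -mulnb natrM mulrCA.
rewrite sumrN -mulr_sumr IH.
by case: (e y z) => /=; case: (path _ z w); rewrite ?mul0r ?mul1r ?subrr ?subr0.
Qed.

(* Splitting a word into an initial run of [e]-links and a final run of
   non-links: the link at the cut is free, so consecutive terms telescope. *)
Lemma alternating_sorted (w : seq T) :
  \sum_(i < (size w).+1)
     (-1) ^+ i * (sorted e (take i w) && sorted (fun a b => ~~ e a b) (drop i w))%:R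
  = (nilp w)%:R :> R.
Proof.
case: w => [|y w]; first by rewrite big_ord1 mul1r.
rewrite big_ord_recl /= expr0 mul1r -alternating_path.
by rewrite -big_split big1 // => i _; rewrite /bump /= add1n exprS mulN1r mulNr addrN.
Qed.
End AlternatingRuns.

(** * Words of given length over a finite alphabet *)

Section Words.
Variables (L : eqType) (A : seq L).

Fixpoint words (n : nat) : seq (seq L) :=
  if n is n'.+1 then [seq y :: w | y <- A, w <- words n'] else [:: [::]].

Lemma mem_words n w : (w \in words n) = (size w == n) && all (mem A) w.
Proof.
elim: n w => [|n IH] [|y w] //=.
  by apply/allpairsP => -[[] ? ? []].
apply/allpairsP/idP => [[[z v] /= [zA vn [-> ->]]]|].
  by move: vn; rewrite IH zA => /andP[/eqP -> ->]; rewrite eqxx.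
rewrite eqSS => /and3P[sw yA wA]; exists (y, w); split=> //=.
by rewrite IH sw.
Qed.

Lemma words_uniq n : uniq A -> uniq (words n).
Proof.
move=> uA; elim: n => //= n IH; apply: allpairs_uniq => // -[y w] [z v] _ _ /=.
by case=> -> ->.
Qed.

Lemma sum_wordsD (V : zmodType) (F : seq L -> V) n m :
  \sum_(w <- words (n + m)) F w =
  \sum_(u <- words n) \sum_(v <- words m) F (u ++ v).
Proof.
elim: n F => [|n IH] F; first by rewrite big_seq1.
rewrite addSn /= !big_allpairs_dep; apply: eq_bigr => y _.
by rewrite IH.
Qed.

End Words.

(** * Power series modulo a power of the variable *)

Section FpsCongruence.
Variable A : comNzRingType.
Implicit Types f g h : fps A.

Definition fps_eqmod (K : nat) f g : Prop := forall d, (d <= K)%N -> f d = g d.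

Lemma fps_eqmodM K f f' g g' :
  fps_eqmod K f f' -> fps_eqmod K g g' -> fps_eqmod K (f * g) (f' * g').
Proof.
move=> ff' gg' d dK; apply: eq_bigr => i _.
by rewrite ff' ?gg' // ?(leq_trans (leq_subr _ _)) // (leq_trans _ dK) // -ltnS.
Qed.

Lemma fps_coefD f g d : (f + g) d = f d + g d. Proof. by []. Qed.
Lemma fps_coefN f d : (- f) d = - f d. Proof. by []. Qed.

Lemma fps_coef_sum (I : Type) (r : seq I) (P : pred I) (F : I -> fps A) d :
  (\sum_(i <- r | P i) F i) d = \sum_(i <- r | P i) F i d.
Proof. exact: (big_morph (fun f : fps A => f d) (fun f g => fps_coefD f g d)). Qed.

Lemma fps_eqmod_sum K (I : eqType) (r : seq I) (P : pred I) (F G : I -> fps A) :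
  (forall i, i \in r -> P i -> fps_eqmod K (F i) (G i)) ->
  fps_eqmod K (\sum_(i <- r | P i) F i) (\sum_(i <- r | P i) G i).
Proof.
move=> FG d dK; rewrite !fps_coef_sum big_seq_cond [RHS]big_seq_cond.
by apply: eq_bigr => i /andP[ir Pi]; apply: FG.
Qed.

Lemma fps_coefXM f d : (fps_X A * f) d = if d is d'.+1 then f d' else 0.
Proof.
case: d => [|d] /=; first by rewrite big_ord1 /= mul0r.
rewrite big_ord_recl /= mul0r add0r big_ord_recl /= mul1r subSS subn0.
by rewrite big1 ?addr0 // => i _; rewrite /= mul0r.
Qed.

Lemma fps_coefXn n d : (fps_X A ^+ n) d = (d == n)%:R.
Proof.
elim: n d => [|n IH] d; first by rewrite expr0.
by rewrite exprS fps_coefXM; case: d => [|d] //; rewrite IH.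
Qed.

Lemma fps_eqmodXn0 K n : (K < n)%N -> fps_eqmod K (fps_X A ^+ n) 0.
Proof.
move=> Kn d dK; rewrite fps_coefXn; case: eqP => // dn; lia.
Qed.

End FpsCongruence.

(** * Letters, overshoots and the alternating identity *)

(* The exponents of [xi_i] are the [e < xi_bound p]; for [p = 2] there are no
   exterior generators and [e = 0]. *)
Definition xi_bound (p : nat) : nat := if p == 2 then 1%N else 2%N.

Definition alphabet (p K : nat) : seq (nat * nat) :=
  [seq (b.+1, e) | b <- iota 0 K, e <- iota 0 (xi_bound p)].

Definition letter_wt (p : nat) (y : nat * nat) : nat :=
  xi_bound p * (p - 1) * y.1 - y.2.

Definition word_wt (p : nat) (w : seq (nat * nat)) : nat :=
  (\sum_(y <- w) letter_wt p y)%N.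

(** Its negation says that the exponent [a = p b - e - b'] of the polynomial generator is
    nonnegative, for consecutive letters [(b, e)] and [(b', e')]. *)
Definition overshoot (p : nat) : rel (nat * nat) :=
  fun y z => (p * y.1 - y.2 < z.1)%N.

Definition words_gf (p K : nat) (P : pred (seq (nat * nat))) (n : nat) : fps int :=
  \sum_(w <- words (alphabet p K) n | P w) fps_X int ^+ word_wt p w.

Notation legal p := (sorted (fun y z => ~~ overshoot p y z)).

Lemma alphabet_uniq p K : uniq (alphabet p K).
Proof.
by apply: allpairs_uniq; rewrite ?iota_uniq // => -[a b] [c d] _ _ /= [-> ->].
Qed.

Lemma mem_alphabet p K b e :
  ((b, e) \in alphabet p K) = [&& 0 < b, b <= K & e < xi_bound p]%N.
Proof.
apply/allpairsP/idP => [[[a c] /= [+ + [-> ->]]]|/and3P[b0 bK eE]].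
  by rewrite !mem_iota /= !add0n => -> ->.
exists (b.-1, e); rewrite !mem_iota /= !add0n eE prednK //; split=> //.
Qed.

Lemma word_wt_cat p u v : word_wt p (u ++ v) = (word_wt p u + word_wt p v)%N.
Proof. exact: big_cat. Qed.

(** Weights add up under concatenation, so the [i]-th product counts words cut at position [i]; by
    [alternating_sorted] the signed cuts of every nonempty word cancel. The identity is exact for
    each [K]. *)
Lemma words_gf_conv p K m :
  \sum_(i < m.+1) (-1) ^+ i *
    (words_gf p K (sorted (overshoot p)) i * words_gf p K (legal p) (m - i))
  = (m == 0)%:R.
Proof.
transitivity (\sum_(w <- words (alphabet p K) m)
   (\sum_(i < (size w).+1) (-1) ^+ i *
     (sorted (overshoot p) (take i w) && legal p (drop i w))%:R)
       * fps_X int ^+ word_wt p w).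
  transitivity (\sum_(i < m.+1) \sum_(w <- words (alphabet p K) m) (-1) ^+ i *
     (sorted (overshoot p) (take i w) && legal p (drop i w))%:R
       * fps_X int ^+ word_wt p w).
    apply: eq_bigr => i _.
    have -> : words (alphabet p K) m = words (alphabet p K) (i + (m - i)).
      by rewrite subnKC // -ltnS.
    rewrite sum_wordsD /words_gf mulr_suml mulr_sumr big_mkcond big_seq [RHS]big_seq.
    apply: eq_bigr => u; rewrite mem_words => /andP[/eqP su _].
    case: ifP => Pu; last first.
      rewrite big1 // => v _.
      by rewrite -{2}su take_size_cat // Pu mulr0 mul0r.
    rewrite mulrA mulr_sumr [LHS]big_mkcond; apply: eq_bigr => v _.
    rewrite take_size_cat // drop_size_cat // Pu.
    by case: ifP => _; rewrite ?mulr0 ?mul0r // mulr1 word_wt_cat exprD mulrA.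
  rewrite exchange_big big_seq [RHS]big_seq; apply: eq_bigr => w.
  by rewrite mem_words => /andP[/eqP sw _]; rewrite mulr_suml sw.
under eq_bigr => w _ do rewrite alternating_sorted.
case: m => [|m]; first by rewrite big_seq1 mul1r /word_wt big_nil.
rewrite big_seq big1 // => -[|y w]; rewrite mem_words //= => _.
by rewrite mul0r.
Qed.

(** * Overshooting runs and the series [ell] *)

Definition run_above (p x : nat) (w : seq (nat * nat)) : bool :=
  if w is y :: w' then (x < y.1)%N && path (overshoot p) y w' else true.

(** The threshold of [run_above] thus replaces the preceding letter, and an induction along the run
    only has to vary this number. *)
Lemma path_overshoot p y w : path (overshoot p) y w = run_above p (p * y.1 - y.2) w.
Proof. by case: w. Qed.

Section EllModulo.
Variables (p : nat) (p_gt1 : (1 < p)%N).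
Let E := xi_bound p.
Let q := fps_X int.

(* In [ell p l.+1 / ell p l], each unit of [e] lowers the exponent by
   [xi_drop l]. *)
Definition xi_drop l := (E * (p ^ l - 1) + 1)%N.

Lemma xi_boundP : (p = 2 /\ E = 1) \/ ((2 < p)%N /\ E = 2).
Proof. rewrite /E /xi_bound; case: eqP => p2; [left | right]; split=> //; lia. Qed.

(** Raising the threshold of a run of [l] letters by one raises its [b_i] by 1, p, p^2, ..., hence
    its weight by [E (p ^ l - 1)]. The left side thus combines a letter with its effect on the [l]
    letters after it; a unit of [e] costs 1 in the letter and [E (p ^ l - 1)] in the run. *)
Lemma letter_wt_run l b e : (e < E)%N -> (0 < b)%N ->
  (letter_wt p (b, e) + (p * b - e) * (E * (p ^ l - 1)) + e * xi_drop l =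
   b * (E * (p ^ l.+1 - 1)))%N.
Proof.
move=> eE b0; rewrite /xi_drop /letter_wt /= expnS -/E.
have : (0 < p ^ l)%N by rewrite expn_gt0; lia.
case: (p ^ l)%N => // s _; rewrite subSS subn0.
have [t tE] : exists t, (t + e = E * (p - 1) * b)%N.
  exists (E * (p - 1) * b - e)%N; case: xi_boundP => -[? Eq]; nia.
have [u uE] : exists u, (u + e = p * b)%N.
  exists (p * b - e)%N; case: xi_boundP => -[? Eq]; nia.
rewrite -tE -uE !addnK.
have -> : (p * s.+1 - 1 = (p - 1) + p * s)%N by nia.
transitivity ((t + e) + (u + e) * (E * s))%N; first ring.
by rewrite tE uE; ring.
Qed.

Lemma xi_drop_lt l e : (e < E)%N -> (e * xi_drop l < E * (p ^ l.+1 - 1))%N.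
Proof.
rewrite /xi_drop expnS.
have : (0 < p ^ l)%N by rewrite expn_gt0; lia.
by case: xi_boundP => -[? ->]; case: e => [|[|e]]; nia.
Qed.

(** The term [e = 0] has exponent [E (p ^ l.+1 - 1)]; for odd [p] the term [e = 1] has exponent
    [2 p ^ l (p - 1) - 1]. One formula so covers both shapes of [ell]. *)
Lemma ellS l :
  ell p l.+1 = ell p l *
    ((\sum_(e <- iota 0 E) q ^+ (E * (p ^ l.+1 - 1) - e * xi_drop l))
       / (1 - q ^+ (E * (p ^ l.+1 - 1)))).
Proof.
rewrite /xi_drop /ell /E /xi_bound /=; case: eqP => [->|p2].
  by rewrite big_nat_recr //= big_seq1 mul0n subn0 mul1n.
rewrite big_nat_recr //= big_cons big_seq1 mul0n subn0 addrC.
congr (_ * ((_ + q ^+ _) / _)).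
have : (0 < p ^ l)%N by rewrite expn_gt0; lia.
rewrite subSS subn0 expnS; case: (p ^ l)%N => // s _.
have -> : (p * s.+1 - 1 = s.+1 * (p - 1) + s)%N by nia.
set t := (s.+1 * _)%N; have -> : (2 * s.+1 * (p - 1) = 2 * t)%N by rewrite /t mulnA.
lia.
Qed.

Lemma geometric_from (A : pzRingType) (Q : A) K x :
  (1 - Q) * \sum_(b <- iota 0 K | (x <= b)%N) Q ^+ b =
  if (x <= K)%N then Q ^+ x - Q ^+ K else 0.
Proof.
elim: K => [|K IH]; first by rewrite big_nil mulr0 leqn0; case: eqP => // ->; rewrite subrr.
rewrite -addn1 iotaD big_cat [X in _ * (_ + X)]big_mkcond big_seq1 add0n /=.
rewrite mulrDr IH addn1.
case: (ltngtP x K) => [xK|xK|->]; rewrite ?mulr0 ?addr0.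
- by rewrite (leqW (ltnW xK)) mulrBl mul1r -exprS addrA subrK.
- by case: ltngtP; rewrite ?addr0 //; [lia | move=> ->; rewrite subrr].
- by rewrite leqnSn subrr add0r mulrBl mul1r -exprS.
Qed.

(** For fixed [e] the sum over [b] is geometric; cutting it off at [b <= K] only loses exponents
    above [K]. *)
Lemma sum_letters_eqmod K l x :
  fps_eqmod K
    ((1 - q ^+ (E * (p ^ l.+1 - 1))) *
       \sum_(y <- alphabet p K | (x < y.1)%N)
          q ^+ (letter_wt p y + (p * y.1 - y.2) * (E * (p ^ l - 1))))
    (q ^+ (x * (E * (p ^ l.+1 - 1))) *
       \sum_(e <- iota 0 E) q ^+ (E * (p ^ l.+1 - 1) - e * xi_drop l)).
Proof.
set c := (E * _)%N.
have -> : \sum_(y <- alphabet p K | (x < y.1)%N)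
          q ^+ (letter_wt p y + (p * y.1 - y.2) * (E * (p ^ l - 1))) =
   \sum_(e <- iota 0 E) q ^+ (c - e * xi_drop l) * 
       \sum_(b <- iota 0 K | (x <= b)%N) (q ^+ c) ^+ b.
  rewrite big_mkcond big_allpairs_dep exchange_big /= big_seq [RHS]big_seq.
  apply: eq_bigr => e; rewrite mem_iota add0n => eE.
  rewrite mulr_sumr [RHS]big_mkcond; apply: eq_bigr => b _ /=.
  rewrite ltnS; case: ifP => // _; rewrite -exprM -exprD; congr (_ ^+ _).
  have := xi_drop_lt l eE; have := @letter_wt_run l b.+1 e eE isT; rewrite -/c mulSn (mulnC b).
  by clearbody c; move: (e * _)%N (c * b)%N (letter_wt _ _ + _)%N => ? ? ?; lia.
rewrite !mulr_sumr; apply: fps_eqmod_sum => e; rewrite mem_iota add0n => eE _.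
have ltc := xi_drop_lt l eE; rewrite -/c in ltc.
rewrite mulrCA geometric_from -!exprM.
(* By [xi_drop_lt], [c - e * xi_drop l] is positive, so the exponent exceeds [K]. *)
have small n : (K <= n)%N -> fps_eqmod K (q ^+ (c - e * xi_drop l + c * n)) 0.
  by move=> Kn; apply: fps_eqmodXn0; nia.
case: ifP => xK d dK; last by rewrite mulr0 -exprD addnC (mulnC x) small //; lia.
by rewrite mulrBr fps_coefD fps_coefN -!exprD [X in _ - X]small // subr0 addnC (mulnC x).
Qed.

(** Removing the first letter [(b, e)] leaves a run above [p b - e], known by induction; the sum
    over first letters is then that of [sum_letters_eqmod]. *)
Lemma runs_gf_eqmod K l x :
  fps_eqmod K (words_gf p K (run_above p x) l)
    (q ^+ (x * (E * (p ^ l - 1))) * ell p l).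
Proof.
elim: l x => [|l IH] x.
  rewrite /words_gf big_mkcond big_seq1 /word_wt big_nil muln0 muln0 /ell !big_nil.
  by case: ifP => _; rewrite mul1r.
pose c := (E * (p ^ l.+1 - 1))%N.
have Uc : 1 - q ^+ c \is a GRing.unit.
  by apply: fps_geom_unit; apply: leq_ltn_trans (@xi_drop_lt l 0 _) => //; case: xi_boundP => -[_ ->].
(* Multiplying by the unit [1 - q ^+ c] clears the denominator of the last factor of [ell]. *)
suff H : fps_eqmod K ((1 - q ^+ c) * words_gf p K (run_above p x) l.+1)
            ((1 - q ^+ c) * (q ^+ (x * c) * ell p l.+1)).
  rewrite -[words_gf _ _ _ _](mulKr Uc) -[X in fps_eqmod _ _ X](mulKr Uc).
  exact: fps_eqmodM.
have -> : (1 - q ^+ c) * (q ^+ (x * c) * ell p l.+1) =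
   q ^+ (x * c) * (\sum_(e <- iota 0 E) q ^+ (c - e * xi_drop l)) * ell p l.
  rewrite ellS -/c; move: (\sum_(e <- _) _) => S.
  rewrite [in LHS]mulrCA -mulrA; congr (_ * _).
  by rewrite [in LHS]mulrCA [in LHS](mulrC S) mulVKr // mulrC.
have step : fps_eqmod K (words_gf p K (run_above p x) l.+1)
   ((\sum_(y <- alphabet p K | (x < y.1)%N)
      q ^+ (letter_wt p y + (p * y.1 - y.2) * (E * (p ^ l - 1)))) * ell p l).
  have -> : words_gf p K (run_above p x) l.+1 =
      \sum_(y <- alphabet p K | (x < y.1)%N) q ^+ letter_wt p y *
         words_gf p K (run_above p (p * y.1 - y.2)) l.
    rewrite /words_gf big_mkcond big_allpairs_dep [RHS]big_mkcond; apply: eq_bigr => y _.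
    case: ifP => xy /=; last by rewrite big1 // => w _; rewrite xy.
    rewrite mulr_sumr [RHS]big_mkcond; apply: eq_bigr => w _.
    rewrite xy path_overshoot /=; case: ifP => // _.
    by rewrite /word_wt big_cons exprD.
  rewrite mulr_suml; apply: fps_eqmod_sum => y _ _.
  by rewrite exprD -mulrA; apply: fps_eqmodM.
move=> d dK; rewrite (@fps_eqmodM _ _ _ (1 - q ^+ c) _ _ _ step) // mulrA.
by apply: (@fps_eqmodM _ K) => //; exact: sum_letters_eqmod.
Qed.

(** Every letter has [b > 0], so a run above 0 is just an overshooting word. *)
Lemma ell_eqmod K l :
  fps_eqmod K (words_gf p K (sorted (overshoot p)) l) (ell p l).
Proof.
move=> d dK; rewrite -[ell p l]mul1r -(expr0 q) -(mul0n (E * (p ^ l - 1))%N) -(@runs_gf_eqmod K l 0 d dK).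
congr (fps_coef _ _); rewrite /words_gf big_seq_cond [RHS]big_seq_cond.
apply: eq_bigl => -[|[b e] w]; rewrite // mem_words /= mem_alphabet.
by case: b => [|b]; rewrite ?andbF.
Qed.

Lemma words_gf_N_coef K m d : (d <= K)%N ->
  words_gf p K (legal p) m d = N_coef p m d.
Proof.
rewrite /N_coef; elim/ltn_ind: m d => m IH d dK.
have := words_gf_conv p K m; rewrite big_ord_recl expr0 mul1r subn0.
have -> : words_gf p K (sorted (overshoot p)) 0 = 1.
  by rewrite /words_gf big_mkcond big_seq1 /word_wt big_nil.
rewrite mul1r => /(canRL (addrK _)) ->.
have := congr1 (fun f : fps (fps int) => f m) (mulrV (N_denom_unit p)).
rewrite /= big_ord_recl subn0 expr0 mul1r.
have -> : ell p 0 = 1 by rewrite /ell !big_nil; case: ifP.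
rewrite mul1r => /(canRL (addrK _)) ->.
rewrite !fps_coefD !fps_coefN; congr (_ - _).
apply: (fps_eqmod_sum (K := K)) => // i _ _; rewrite -mulrA.
apply: fps_eqmodM => //; apply: fps_eqmodM; first exact: ell_eqmod.
move=> d' d'K; apply: IH => //.
have := ltn_ord i; rewrite /bump /=; lia.
Qed.

End EllModulo.

(** * Monomials of integer degree *)

Definition legal_words (p d m : nat) : seq (seq (nat * nat)) :=
  [seq w <- words (alphabet p d) m | legal p w && (word_wt p w == d)].

(** [b j] is the tail sum [T j] divided by [p ^ (n - j)]. Divisibility is the hypothesis at [j = 0]
    and passes from [T j] to [T j.+1], as these differ by a multiple of [p ^ (n - j.+1)]. *)
Lemma digit_sums (p n : nat) (c : 'I_n -> nat) : (0 < p)%N ->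
  (p ^ n %| \sum_(i < n) c i * p ^ (n - i.+1))%N ->
  exists b : nat -> nat, b n = 0%N /\ forall i : 'I_n, (p * b i = c i + b i.+1)%N.
Proof.
move=> p0 dvd.
pose T j := (\sum_(i < n | j <= i) c i * p ^ (n - i.+1))%N.
have TS (j : 'I_n) : (T j = c j * p ^ (n - j.+1) + T j.+1)%N.
  rewrite /T (bigD1 j) //=; congr (_ + _)%N; apply: eq_bigl => i.
  by rewrite -val_eqE /= ltn_neqAle eq_sym andbC.
have expE (j : 'I_n) : (p ^ (n - j) = p * p ^ (n - j.+1))%N.
  by rewrite -expnS; congr (p ^ _)%N; have := ltn_ord j; lia.
have dvdT j : (j <= n)%N -> (p ^ (n - j) %| T j)%N.
  elim: j => [|j IH] jn; first by rewrite subn0.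
  have := IH (ltnW jn); rewrite (TS (Ordinal jn)) (expE (Ordinal jn)) /=.
  by move=> /(dvdn_trans (dvdn_mull p (dvdnn _))); rewrite dvdn_addr // dvdn_mull.
exists (fun j => T j %/ p ^ (n - j))%N; split.
  by rewrite /T big_pred0 ?div0n // => i; rewrite leqNgt ltn_ord.
move=> i; have ltin := ltn_ord i.
have P0 : (0 < p ^ (n - i.+1))%N by rewrite expn_gt0 p0.
apply/eqP; rewrite -(eqn_pmul2r P0) mulnDl divnK ?dvdT // -TS mulnAC -expE mulnC.
by rewrite divnK // dvdT // ltnW.
Qed.

Section Monomials.
Variables (p : nat) (p_prime : prime p).
Let p_gt1 : (1 < p)%N := prime_gt1 p_prime.

Definition x_deg (i : nat) : rat := if p == 2 then deg_x_even i else deg_x_odd p i.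

Definition monomial_deg n (S : {set 'I_n}) (m : 'X_{1..n}) : rat :=
  mnm_deg x_deg m + xi_deg p S.

(** For [p = 2] there are no exterior generators; restricting to [S = set0] lets pairs [(S, m)]
    index the monomials in both cases. *)
Definition xi_allowed n (S : {set 'I_n}) : bool := (p == 2) ==> (S == set0).

(** Hence a word of weight [d] has all [b <= d], and bounding the alphabet by [d] loses nothing. *)
Lemma letter_wt_ge b e : (0 < b)%N -> (e < xi_bound p)%N -> (b <= letter_wt p (b, e))%N.
Proof.
by rewrite /letter_wt /=; case: (xi_boundP p_gt1) => -[? ->]; nia.
Qed.

Lemma word_wt_size K w : all (mem (alphabet p K)) w -> (size w <= word_wt p w)%N.
Proof.
rewrite /word_wt; elim: w => //= -[b e] w IH /andP[]; rewrite mem_alphabet big_cons.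
move=> /and3P[b0 _ eE] /IH; have := letter_wt_ge b0 eE; lia.
Qed.

(** The padding [(0, 0)] has weight 0 and stands for the tail of vanishing [b_i]. *)
Lemma word_wt_nth n w : (size w <= n)%N ->
  word_wt p w = (\sum_(i < n) letter_wt p (nth (0, 0) w i))%N.
Proof.
move=> wn; rewrite -(big_mkord xpredT (fun i => letter_wt p (nth (0, 0)%N w i))).
rewrite (big_cat_nat _ wn) //= [X in (_ + X)%N](_ : _ = 0%N).
  by rewrite addn0 /word_wt (big_nth (0, 0)%N).
rewrite big_nat big1 // => i /andP[iw _].
by rewrite nth_default // /letter_wt muln0.
Qed.

Lemma size_legal_words d m : (size (legal_words p d m))%:Z = N_coef p m d.
Proof.
rewrite -(words_gf_N_coef p_gt1 m (leqnn d)) /words_gf fps_coef_sum.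
rewrite size_filter -sum1_count rmorph_sum /= big_mkcondr.
by apply: eq_bigr => w _; rewrite fps_coefXn eq_sym; case: eqP.
Qed.

(** Each letter weighs at least 1, so [m] letters cannot have total weight [d < m]. *)
Lemma N_coef_eq0 d m : (d < m)%N -> N_coef p m d = 0.
Proof.
move=> dm; rewrite -size_legal_words; apply/eqP; rewrite eqz_nat size_eq0.
apply/eqP/eqP; rewrite -[_ == _]negbK -has_filter; apply/hasPn => w.
rewrite mem_words => /andP[/eqP sw /word_wt_size]; rewrite sw => mw.
by apply/negP => /andP[_ /eqP wd]; lia.
Qed.

(** Rests on [|x_i| = E (1 - p^-i)] and [|xi_i| = E (1 - p^-i) - 1]. *)
Lemma monomial_degE n (S : {set 'I_n}) (m : 'X_{1..n}) : xi_allowed S ->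
  monomial_deg S m =
  \sum_(i < n) ((xi_bound p)%:R * (m i + (i \in S))%:R * (1 - (p%:R ^+ i.+1)^-1) - (i \in S)%:R).
Proof.
move=> SP; rewrite /monomial_deg /mnm_deg /xi_deg [X in _ + X]big_mkcond -big_split.
apply: eq_bigr => i _ /=; rewrite natrD.
have P0 : p%:R ^+ i.+1 != 0 :> rat by rewrite expf_neq0 // pnatr_eq0; lia.
rewrite /x_deg /xi_bound; move: SP; rewrite /xi_allowed; case: eqP => [p2 /eqP ->|p2 _].
  rewrite inE /= addr0 /deg_x_even; move: P0; rewrite p2 => P0.
  by field.
rewrite /deg_x_odd /deg_xi_odd; by case: (i \in S) => /=; field; exact: P0.
Qed.

Lemma monomial_deg_letters n (S : {set 'I_n}) (m : 'X_{1..n}) (b : nat -> nat) :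
  xi_allowed S -> b n = 0%N ->
  (forall i : 'I_n, (p * b i = m i + (i \in S) + b i.+1)%N) ->
  monomial_deg S m = (\sum_(i < n) letter_wt p (b i, nat_of_bool (i \in S)))%:R.
Proof.
move=> SP bn bP; rewrite monomial_degE // natr_sum.
(* Corresponding summands of the two sides differ by [g i.+1 - g i], which telescopes to 0:
   [g 0 = 0] by its last factor, and [g n = 0] since [b n = 0]. *)
pose g i : rat := (xi_bound p)%:R * (b i)%:R * (1 - (p%:R ^+ i)^-1).
have g0 : \sum_(0 <= i < n) (g i.+1 - g i) = 0.
  by rewrite telescope_sumr // /g bn expr0 invr1 subrr !(mulr0, mul0r) subrr.
rewrite -[RHS]subr0 -[X in _ = _ - X]g0 big_mkord -sumrB; apply: eq_bigr => i _.
have le_wt : ((i \in S) <= xi_bound p * (p - 1) * b i)%N.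
  by have := bP i; case: (i \in S) => //; case: (xi_boundP p_gt1) => -[? ->]; nia.
have cE : (m i + (i \in S))%:R = p%:R * (b i)%:R - (b i.+1)%:R :> rat.
  by rewrite -natrM bP [in RHS]natrD addrK.
have P0 : p%:R != 0 :> rat by rewrite pnatr_eq0; lia.
rewrite cE /letter_wt /= natrB // !natrM natrB ?(ltnW p_gt1) // /g.
have := expf_neq0 i P0; rewrite exprS; move: (p%:R ^+ i) => Q Q0.
by field; rewrite Q0.
Qed.

(** Multiplying the degree by [p ^ n] shows that [p ^ n] divides [E] times the sum in [digit_sums],
    and [E] is prime to [p]. *)
Lemma integral_monomial n (S : {set 'I_n}) (m : 'X_{1..n}) (d : nat) :
  xi_allowed S -> monomial_deg S m = d%:R ->
  exists b : nat -> nat, b n = 0%N /\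
    forall i : 'I_n, (p * b i = m i + (i \in S) + b i.+1)%N.
Proof.
move=> SP; rewrite monomial_degE // => degd.
apply: digit_sums; first exact: ltnW.
have coE : coprime (p ^ n) (xi_bound p).
  apply: coprimeXl; case: (xi_boundP p_gt1) => -[p2 ->]; first exact: coprimen1.
  by rewrite coprime_sym prime_coprime // dvdn_prime2 //; lia.
rewrite -(Gauss_dvdr _ coE).
suff H : (xi_bound p * (\sum_(i < n) (m i + (i \in S)) * p ^ (n - i.+1))
          + (\sum_(i < n) (i \in S) + d) * p ^ n
          = (\sum_(i < n) xi_bound p * (m i + (i \in S))) * p ^ n)%N.
  by rewrite -(dvdn_addl _ (dvdn_mull (\sum_(i < n) (i \in S) + d) (dvdnn _))) H dvdn_mull.
apply/eqP; rewrite -(eqr_nat rat) !(natrD, natrM, natr_sum, natrX) -degd.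
rewrite mulrDl !mulr_suml mulr_sumr -!big_split /=; apply/eqP/eq_bigr => i _.
have P0 : p%:R != 0 :> rat by rewrite pnatr_eq0; lia.
have -> : p%:R ^+ n = p%:R ^+ (n - i.+1) * p%:R ^+ i.+1 :> rat by rewrite -exprD subnK.
rewrite !(natrM, natrX); move: (expf_neq0 i.+1 P0).
move: (p%:R ^+ i.+1) => Q Q0; move: (p%:R ^+ _) => Q'.
by field.
Qed.

(** * The bijection between legal words and monomials *)

Section Encoding.
Variable n : nat.
Implicit Types w : seq (nat * nat).

Definition word_xi w : {set 'I_n} := [set i : 'I_n | (nth (0, 0)%N w i).2 == 1%N].

Definition word_mnm w : 'X_{1..n} :=
  [multinom (p * (nth (0, 0) w i).1 - (nth (0, 0) w i.+1).1 - (nth (0, 0) w i).2)%N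
   | i < n].

Lemma word_xi_nat K w (i : 'I_n) : all (mem (alphabet p K)) w ->
  (i \in word_xi w : nat) = (nth (0, 0)%N w i).2.
Proof.
move=> wA; rewrite inE; have [iw|iw] := ltnP i (size w); last by rewrite nth_default.
have := all_nthP (0, 0)%N wA i iw; case: (nth _ _ _) => b e /=.
by rewrite mem_alphabet => /and3P[_ _]; case: (xi_boundP p_gt1) => -[_ ->]; case: e => [|[]].
Qed.

Lemma word_xi_allowed K w : all (mem (alphabet p K)) w -> xi_allowed (word_xi w).
Proof.
move=> wA; apply/implyP => /eqP p2; apply/eqP/setP => i; rewrite !inE.
have [iw|iw] := ltnP i (size w); last by rewrite nth_default.
have := all_nthP (0, 0)%N wA i iw; case: (nth _ _ _) => b e /=.
by rewrite mem_alphabet /xi_bound p2 => /and3P[_ _]; case: e.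
Qed.

(** The truncated subtractions in [word_mnm] are exact: between two letters by legality, at the last
    letter because [e <= p b], and beyond it because the default [(0, 0)] makes all terms vanish. *)
Lemma word_step K w (i : 'I_n) : all (mem (alphabet p K)) w -> legal p w ->
  (p * (nth (0, 0) w i).1 =
    word_mnm w i + (i \in word_xi w) + (nth (0, 0) w i.+1).1)%N.
Proof.
move=> wA wl; rewrite (word_xi_nat _ wA) mnmE.
have [iw|iw] := ltnP i (size w); last by rewrite !nth_default ?(leqW iw) //= !muln0.
have := all_nthP (0, 0)%N wA i iw.
have : (i.+1 < size w)%N ->
    ~~ overshoot p (nth (0, 0)%N w i) (nth (0, 0)%N w i.+1).
  by move=> iw1; move/(sortedP (0, 0)%N): wl; apply.
rewrite /overshoot; have [iw1 /(_ isT)|iw1 _] := ltnP i.+1 (size w); last first.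
  rewrite [nth _ w i.+1]nth_default //; case: (nth _ w i) => b e /=; rewrite mem_alphabet => /and3P[].
  by case: (xi_boundP p_gt1) => -[? ->]; nia.
case: (nth _ w i.+1) => b' e'; case: (nth _ w i) => b e /=; rewrite mem_alphabet => + /and3P[].
by case: (xi_boundP p_gt1) => -[? ->]; nia.
Qed.

(** From [b_n = 0] the relation of [word_step] determines the [b_i] downwards. The length is
    recovered because exactly the true letters have [b > 0]. *)
Lemma word_code_inj K w w' :
  all (mem (alphabet p K)) w -> legal p w -> (size w <= n)%N ->
  all (mem (alphabet p K)) w' -> legal p w' -> (size w' <= n)%N ->
  word_xi w = word_xi w' -> word_mnm w = word_mnm w' -> w = w'.
Proof.
move=> wA wl wn wA' wl' wn' eqS eqm.
have eqb j : (j <= n)%N ->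
    (nth (0, 0)%N w (n - j)).1 = (nth (0, 0)%N w' (n - j)).1.
  elim: j => [|j IH] jn; first by rewrite subn0 !nth_default.
  have ltn : (n - j.+1 < n)%N by lia.
  have := word_step (Ordinal ltn) wA wl; have := word_step (Ordinal ltn) wA' wl'.
  rewrite eqS eqm /= -subSn // subSS -(IH (ltnW jn)) => <- /eqP.
  by rewrite eqn_pmul2l ?(ltnW p_gt1) // => /eqP.
have eqw i : nth (0, 0)%N w i = nth (0, 0)%N w' i.
  have [iltn|nlei] := ltnP i n; last by rewrite !nth_default // (leq_trans _ nlei).
  rewrite [LHS]surjective_pairing [RHS]surjective_pairing; congr (_, _).
    by rewrite -(subKn (ltnW iltn)) eqb // leq_subr.
  have := word_xi_nat (Ordinal iltn) wA; have := word_xi_nat (Ordinal iltn) wA'.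
  by rewrite eqS /= => <-.
have pos v i : all (mem (alphabet p K)) v -> (i < size v)%N = (0 < (nth (0, 0)%N v i).1)%N.
  move=> vA; have [iv|iv] := ltnP; last by rewrite nth_default.
  have := all_nthP (0, 0)%N vA i iv; case: (nth _ _ _) => b e /=.
  by rewrite mem_alphabet => /andP[->].
have ltE i : (i < size w)%N = (i < size w')%N by rewrite (pos w) // (pos w') // eqw.
apply: (@eq_from_nth _ (0, 0)%N) => [|i _]; last exact: eqw.
by apply: anti_leq; rewrite leqNgt (ltE (size w')) ltnn leqNgt -(ltE (size w)) ltnn.
Qed.

(** The word consists of the letters [(b_i, e_i)] before the first zero [b_l]. Once [b_i = 0], the
    relation forces [a_i], [e_i] and [b_(i+1)] to vanish, so stopping there keeps the whole
    monomial. *)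
Lemma word_code_surj (S : {set 'I_n}) (m : 'X_{1..n}) d :
  xi_allowed S -> monomial_deg S m = d%:R ->
  exists w, [/\ (size w <= n)%N, w \in legal_words p d (size w),
                word_xi w = S & word_mnm w = m].
Proof.
move=> SP degd; have [b [bn bP]] := integral_monomial SP degd.
have bz : exists j, b j == 0%N by exists n; rewrite bn.
case: (ex_minnP bz) => l /eqP bl lmin.
have ln : (l <= n)%N by apply: lmin; rewrite bn.
have b_gt0 i : (i < l)%N -> (0 < b i)%N.
  by move=> il; rewrite lt0n; apply/negP => /lmin; rewrite leqNgt il.
have b_eq0 i : (l <= i <= n)%N -> b i = 0%N.
  elim: i => [|i IH] /andP[]; first by rewrite leqn0 => /eqP l0 _; move: bl; rewrite l0.
  rewrite leq_eqVlt => /orP[/eqP <- //|li] ltin.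
  have := bP (Ordinal ltin); rewrite /= IH ?(ltnW ltin) ?andbT //; lia.
(* The indicator of [S], extended by 0 to all natural numbers. *)
pose e i := nat_of_bool (i \in [seq val j | j <- enum S]).
have eE (i : 'I_n) : e i = (i \in S) by rewrite /e (mem_map val_inj) mem_enum.
have e_lt i : (e i < xi_bound p)%N.
  rewrite /e /xi_bound; move: SP; rewrite /xi_allowed.
  by case: (p == 2) => [/eqP ->|_]; rewrite ?enum_set0 //; case: (_ \in _).
pose w := mkseq (fun i => (b i, e i)) l.
have sw : size w = l by rewrite size_mkseq.
have nthw i : (i <= n)%N -> (nth (0, 0)%N w i).1 = b i.
  move=> leqin; have [il|il] := ltnP i l; first by rewrite nth_mkseq.
  by rewrite nth_default ?sw // b_eq0 // il.
have nthe (i : 'I_n) : (nth (0, 0)%N w i).2 = (i \in S).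
  have [il|il] := ltnP i l; first by rewrite nth_mkseq //= eE.
  rewrite nth_default ?sw //=; case iS: (i \in S) => //.
  have := bP i; rewrite iS b_eq0 ?il ?(ltnW (ltn_ord i)) //; lia.
have wt : word_wt p w = d.
  apply/eqP; rewrite -(eqr_nat rat) -degd (monomial_deg_letters SP bn bP) eqr_nat.
  rewrite (@word_wt_nth n) ?sw //; apply/eqP/eq_bigr => i _.
  by rewrite [nth _ _ _]surjective_pairing nthe nthw // ltnW.
have wA : all (mem (alphabet p d)) w.
  apply/allP => -[c f] /= /mapP[i]; rewrite mem_iota /= add0n => il [-> ->].
  rewrite mem_alphabet b_gt0 // e_lt andbT -wt /word_wt.
  have yw : (b i, e i) \in w by apply: map_f; rewrite mem_iota.
  rewrite (big_rem _ yw) /=; apply: leq_trans (leq_addr _ _).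
  by apply: letter_wt_ge; rewrite ?b_gt0 ?e_lt.
have wl : legal p w.
  apply/(sortedP (0, 0)%N) => i; rewrite sw => il.
  have ltin : (i < n)%N by lia.
  rewrite !nth_mkseq ?(ltnW il) // /overshoot /= (eE (Ordinal ltin)).
  have := bP (Ordinal ltin); rewrite /=; lia.
exists w; split.
- by rewrite sw.
- by rewrite mem_filter mem_words wl wt !eqxx.
- by apply/setP => i; rewrite inE nthe; case: (i \in S).
- apply/mnmP => i; rewrite mnmE nthe !nthw //; last exact: ltnW.
  have := bP i; lia.
Qed.

(** The list is the image of the legal words of weight [d] and length at most [n]; length [j]
    contributes [N_coef p j d] of them. *)
Lemma integral_monomials d :
  exists s : seq ({set 'I_n} * 'X_{1..n}),
    [/\ uniq s,
        forall S m, ((S, m) \in s) = xi_allowed S && (monomial_deg S m == d%:R)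
      & (size s)%:Z = \sum_(0 <= j < n.+1) N_coef p j d].
Proof.
pose ws := [seq w | j <- iota 0 n.+1, w <- legal_words p d j].
have wsP w : w \in ws ->
    [/\ all (mem (alphabet p d)) w, legal p w, (size w <= n)%N & word_wt p w = d].
  move=> /allpairsPdep[j [v [jn + ->]]]; rewrite mem_filter mem_words.
  move=> /andP[/andP[vl /eqP vd] /andP[/eqP sv vA]]; split=> //.
  by rewrite sv; move: jn; rewrite mem_iota.
exists [seq (word_xi w, word_mnm w) | w <- ws]; split.
- rewrite map_inj_in_uniq; last first.
    move=> w v /wsP[wA wl wn _] /wsP[vA vl vn _] eqc.
    apply: (word_code_inj wA wl wn vA vl vn); first exact: (congr1 fst eqc).
    exact: (congr1 snd eqc).
  apply: allpairs_uniq_dep; first exact: iota_uniq.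
    by move=> j _; apply/filter_uniq/words_uniq/alphabet_uniq.
  move=> [j w] [i v] /allpairsPdep[j' [w' [_ + [-> ->]]]] /allpairsPdep[i' [v' [_ + [-> ->]]]] /=.
  rewrite !mem_filter !mem_words => /andP[_ /andP[/eqP <- _]] /andP[_ /andP[/eqP <- _]].
  by move=> ->.
- move=> S m; apply/mapP/andP => [[w /wsP[wA wl wn wd] eqc]|[SP /eqP degd]].
    have -> : S = word_xi w := congr1 fst eqc; have -> : m = word_mnm w := congr1 snd eqc.
    have SP := word_xi_allowed wA; split=> //.
    rewrite (monomial_deg_letters (b := fun i => (nth (0, 0)%N w i).1) SP); last 2 first.
    + by rewrite nth_default.
    + by move=> i; exact: word_step wA wl.
    rewrite eqr_nat -wd (word_wt_nth wn); apply/eqP/eq_bigr => i _ /=.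
    by rewrite (word_xi_nat _ wA) -surjective_pairing.
  have [w [wn wL <- <-]] := word_code_surj SP degd; exists w => //.
  apply/allpairsPdep; exists (size w), w; split=> //.
  by rewrite mem_iota.
- rewrite size_map size_allpairs_dep sumnE big_map rmorph_sum /=.
  by rewrite /index_iota subn0; apply: eq_bigr => j _; rewrite size_legal_words.
Qed.
End Encoding.
End Monomials.

(** * Bases of homogeneous components *)

Lemma has_dim_coordinates (k : fieldType) (V : lmodType k) (U : V -> Prop)
    (T : eqType) (s : seq T) (v : T -> V) (cf : T -> V -> k) :
  uniq s ->
  (forall t a x y, cf t (a *: x + y) = a * cf t x + cf t y) ->
  (forall t u, cf t (v u) = (t == u)%:R) ->
  (forall t, t \in s -> U (v t)) ->
  (forall x, U x -> x = \sum_(t <- s) cf t x *: v t) ->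
  has_dim U (size s).
Proof.
move=> us cf_lin cf_v Uv cf_span; pose t_ := tnth (in_tuple s).
have t_inj : injective t_ by apply/tuple_uniqP.
exists (fun i => v (t_ i)); split.
- by move=> i; apply/Uv/mem_tnth.
- move=> c c0 i; have cf0 t : cf t 0 = 0.
    by have := cf_lin t 1 0 0; rewrite scaler0 addr0 mul1r => /esym/(canRL (addrK _)); rewrite subrr.
  have cf_sum t (r : seq 'I_(size s)) :
      cf t (\sum_(j <- r) c j *: v (t_ j)) = \sum_(j <- r) c j * (t == t_ j)%:R.
    by elim: r => [|j r IH]; rewrite ?big_nil ?big_cons ?cf0 // cf_lin IH cf_v.
  (* Applying the dual functional [cf (t_ i)] to the relation isolates [c i]. *)
  have := cf_sum (t_ i) (index_enum 'I_(size s)); rewrite c0 cf0 (bigD1 i) //= eqxx mulr1.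
  rewrite big1 ?addr0 // => j /negbTE ji.
  by rewrite (inj_eq t_inj) eq_sym ji mulr0.
- move=> x Ux; exists (fun i => cf (t_ i) x); rewrite {1}(cf_span x Ux).
  by rewrite big_tnth.
Qed.

(** Homogeneous elements of integer degree lie in Int(A), so the same basis serves. *)
Lemma has_dim_Int (k : fieldType) (A : gralg k rat) (d : int) D :
  has_dim (@gr_comp k rat A d%:~R) D -> has_dim (@gr_comp k int (IntGr A) d) D.
Proof.
move=> [b [bd b_free b_span]].
have bI i : b i \in @int_pred k A by apply: int_pred_deg; exists d; exact: bd.
have valE (c : 'I_D -> k) :
    int_val (\sum_(i < D) c i *: (IntAlg (bI i) : IntGr A)) = \sum_(i < D) c i *: b i.
  by rewrite -[LHS]/(val _) raddf_sum.
exists (fun i => IntAlg (bI i)); split.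
- by move=> i; exact: bd.
- by move=> c c0; apply: b_free; rewrite -valE c0.
- move=> v /b_span[c vE]; exists c; apply/val_inj.
  by rewrite /= valE.
Qed.

Lemma has_dim_poly (k : fieldType) (w : nat -> rat) n (d : rat) (s : seq 'X_{1..n}) :
  uniq s -> (forall m, (m \in s) = (mnm_deg w m == d)) ->
  has_dim (@poly_comp k w n d) (size s).
Proof.
move=> us sP; apply: (@has_dim_coordinates _ _ _ _ s (fun m => 'X_[m]) (fun m P => P@_m)) => //.
- by move=> m a P Q; rewrite mcoeffD mcoeffZ.
- by move=> m m'; rewrite mcoeffX eq_sym.
- by move=> m; rewrite sP => /eqP <-; exact: poly_compX.
- move=> P HP; apply/mpolyP => m; rewrite raddf_sum /=.
  under eq_bigr => m' _ do rewrite mcoeffZ mcoeffX.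
  have [ms|ms] := boolP (m \in s).
    rewrite (bigD1_seq m) //= eqxx mulr1 big1 ?addr0 // => m' /negbTE ->.
    by rewrite mulr0.
  rewrite big_seq big1 => [|m' m's]; last first.
    by case: eqP => [m'm|_]; rewrite ?mulr0 //; move: ms; rewrite -m'm m's.
  apply: memN_msupp_eq0; apply: contra ms => /HP md.
  by rewrite sP md.
Qed.

Lemma has_dim_ext (k : fieldType) p n (d : rat) (s : seq ({set 'I_n} * 'X_{1..n})) :
  uniq s ->
  (forall S m, ((S, m) \in s) = (mnm_deg (deg_x_odd p) m + xi_deg p S == d)) ->
  has_dim (@ext_comp k p n d) (size s).
Proof.
move=> us sP.
pose v (t : {set 'I_n} * 'X_{1..n}) : extalg {mpoly k[n]} n :=
  [ffun S => if S == t.1 then 'X_[t.2] else 0].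
pose cf (t : {set 'I_n} * 'X_{1..n}) (f : extalg {mpoly k[n]} n) := (f t.1)@_t.2.
have cf_v t u : cf t (v u) = (t == u)%:R.
  case: t u => [S m] [S' m']; rewrite /cf /v ffunE /= xpair_eqE.
  by case: (S == S'); rewrite ?mcoeff0 // mcoeffX eq_sym.
apply: (@has_dim_coordinates _ _ _ _ s v cf) => //.
- by move=> t a f g; rewrite /cf !ffunE mcoeffD mcoeffZ.
- move=> [S m]; rewrite sP => /eqP degd S' m'; rewrite ffunE /=.
  by case: eqP => [->|_]; rewrite ?msupp0 // msuppX inE => /eqP ->.
- move=> f Hf; apply/ffunP => S; apply/mpolyP => m.
  rewrite sum_ffunE raddf_sum /=.
  transitivity (\sum_(t <- s) cf t f * ((S, m) == t)%:R); last first.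
    by apply: eq_bigr => t _; rewrite -cf_v /cf [in RHS]ffunE mcoeffZ.
  have [ts|ts] := boolP ((S, m) \in s).
    rewrite (bigD1_seq (S, m)) //= eqxx mulr1 big1 ?addr0 // => t.
    by rewrite eq_sym => /negbTE ->; rewrite mulr0.
  rewrite big_seq big1 => [|t t_s]; last first.
    by case: eqP => [tE|_]; rewrite ?mulr0 //; move: ts; rewrite tE t_s.
  apply: memN_msupp_eq0; apply: contra ts => /Hf md.
  by rewrite sP md.
Qed.

(** * Direct limits along injective maps *)

Lemma graded_sum (k : fieldType) (I : zmodType) (A : gralg k I) (i : I) D
    (c : 'I_D -> k) (b : 'I_D -> A) :
  (forall j, gr_comp i (b j)) -> gr_comp i (\sum_(j < D) c j *: b j).
Proof.
move=> bi; elim/big_ind: _ => [|x y xi yi|j _].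
- exact: (grading_submod0 (gr_ax A)).
- by rewrite -[x]scale1r; apply: (grading_linear (gr_ax A)).
- rewrite -[_ *: _]addr0; apply: (grading_linear (gr_ax A)) => //.
  exact: (grading_submod0 (gr_ax A)).
Qed.

(** The matrix [M] of [f] in the two bases is square and injectivity makes its kernel trivial, so it
    is invertible. *)
Lemma grmor_surj_of_dim (k : fieldType) (I : zmodType) (A B : gralg k I)
    (f : grmor A B) (i : I) D :
  injective f -> has_dim (@gr_comp k I A i) D -> has_dim (@gr_comp k I B i) D ->
  forall y, gr_comp i y -> exists x, gr_comp i x /\ f x = y.
Proof.
move=> f_inj [b [bi b_free b_span]] [b' [b'i b'_free b'_span]] y yi.
have /fin_all_exists[M0 M0P] j : exists c : 'I_D -> k, f (b j) = \sum_(l < D) c l *: b' l.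
  exact/b'_span/gr_fun_comp.
pose M := \matrix_(j < D, l < D) M0 j l.
have fM (u : 'rV_D) :
    f (\sum_(j < D) u 0 j *: b j) = \sum_(l < D) (u *m M) 0 l *: b' l.
  rewrite raddf_sum /=; under eq_bigr => j _ do rewrite linearZ /= M0P scaler_sumr.
  rewrite exchange_big; apply: eq_bigr => l _; rewrite mxE scaler_suml.
  by apply: eq_bigr => j _; rewrite mxE scalerA.
have M_unit : M \in unitmx.
  rewrite -row_free_unit -kermx_eq0; apply/rowV0P => u /sub_kermxP uM.
  apply/rowP => j; rewrite mxE; apply: (b_free (fun j => u 0 j)).
  apply: f_inj; rewrite fM uM raddf0 big1 // => l _.
  by rewrite mxE scale0r.
have [c ->] := b'_span y yi.
pose u := (\row_l c l) *m invmx M.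
exists (\sum_(j < D) u 0 j *: b j); split; first exact: graded_sum.
by rewrite fM mulmxKV //; apply: eq_bigr => l _; rewrite mxE.
Qed.

Section ColimDim.
Variables (k : fieldType) (I : zmodType).
Variables (E : nat -> gralg k I) (f : forall n, grmor (E n) (E n.+1)).
Hypothesis f_inj : forall n, injective (f n).

Lemma push_inj n m : (n <= m)%N -> injective (@push k I E f n m).
Proof.
elim: m => [|m IH]; first by rewrite leqn0 => /eqP n0; subst n => x y; rewrite !push_id.
rewrite leq_eqVlt => /orP[/eqP nm|]; first by subst n => x y; rewrite !push_id.
by rewrite ltnS => nm x y; rewrite !pushS // => /f_inj /(IH nm).
Qed.

(** From stage [n0] on, the transition maps are bijective in degree [i], so a basis at stage [n0]
    maps to a basis of the limit. *)
Lemma has_dim_colim (i : I) (n0 D : nat) :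
  (forall n, (n0 <= n)%N -> has_dim (@gr_comp k I (E n) i) D) ->
  has_dim (@gr_comp k I (ColimGr f) i) D.
Proof.
move=> dimE; have [b [bi b_free b_span]] := dimE n0 (leqnn n0).
have push_surj m y : (n0 <= m)%N -> @gr_comp k I (E m) i y ->
    exists x : E n0, gr_comp i x /\ push f m x = y.
  elim: m y => [|m IH] y.
    by rewrite leqn0 => /eqP n0E; subst n0 => yi; exists y; rewrite push_id.
  rewrite leq_eqVlt => /orP[/eqP nm yi|]; first by subst n0; exists y; rewrite push_id.
  rewrite ltnS => nm yi.
  have [z [zi <-]] := grmor_surj_of_dim (f_inj (n := m)) (dimE _ nm) (dimE _ (leqW nm)) yi.
  by have [x [xi <-]] := IH z nm zi; exists x; rewrite pushS.
exists (fun j => colim_in f (b j)); split.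
- by move=> j; exists n0, (b j).
- move=> c c0; apply: b_free.
  have : colim_in f (\sum_(j < D) c j *: b j) = colim_in f (0 : E n0).
    rewrite colim_in_sum colim_in0 -[RHS]c0; apply: eq_bigr => j _.
    by rewrite colim_inZ.
  by move=> /colim_inP[N [nN _ /(push_inj nN)]].
- move=> _ [n [a [ai ->]]].
  (* A representative is pushed to stage [maxn n n0] and pulled back to stage [n0]. *)
  have [nN n0N] := (leq_maxl n n0, leq_maxr n n0).
  have [x [xi xE]] := push_surj _ _ n0N (push_comp f nN ai).
  have [c xc] := b_span x xi; exists c.
  rewrite -(colim_in_push _ _ nN) -xE colim_in_push // xc colim_in_sum.
  by apply: eq_bigr => j _; rewrite colim_inZ.
Qed.
End ColimDim.

(** * The dimension formulas *)

Lemma ext_widen_inj (k : fieldType) p n : injective (@ext_widen k p n).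
Proof.
move=> f g fg; apply/ffunP => S; apply: inj_mwiden.
by rewrite -(ext_widenE f) -(ext_widenE g) fg.
Qed.

Lemma E_incl_inj (k : fieldType) (p n : nat) : injective (E_incl k p n).
Proof.
rewrite /E_incl /E_alg /R_sys; case: ifP => _ x y /(congr1 (@int_val _ _)) /=.
  by move/inj_mwiden => xy; apply/val_inj.
by move/ext_widen_inj => xy; apply/val_inj.
Qed.

Lemma dim_E_alg (k : fieldType) (p : nat) (p_prime : prime p) (n d : nat) :
  exists D : nat, has_dim (@gr_comp k int (E_alg k p n) d%:Z) D /\
    D%:Z = \sum_(0 <= m < n.+1) N_coef p m d.
Proof.
have [s [us sP <-]] := integral_monomials p_prime n d; exists (size s); split=> //.
move: sP; rewrite /monomial_deg /x_deg /xi_allowed.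
rewrite /E_alg /R_sys; case: eqP => [p2|p2] /= sP; apply: has_dim_Int.
  (* For [p = 2] the set component is always [set0], so dropping it keeps the list free of
     repetitions. *)
  have s1 t : t \in s -> t.1 = set0.
    by case: t => S m; rewrite sP => /andP[/eqP].
  rewrite -(size_map (fun t => t.2)); apply: has_dim_poly.
    rewrite map_inj_in_uniq // => -[S m] [S' m'] /s1 /= -> /s1 /= ->.
    by move=> ->.
  move=> m; apply/mapP/idP => [[[S m'] + ->]|degd].
    rewrite sP => /andP[/eqP -> /=].
    by rewrite /xi_deg big_set0 addr0.
  by exists (set0, m); rewrite // sP eqxx /xi_deg big_set0 addr0.
by apply: has_dim_ext => // S m; rewrite sP.
Qed.

Theorem theorem1p2 (p : nat) (p_prime : prime p)
    (k : fieldType) (char_k : p \in [pchar k]) :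
  (forall n d : nat, exists D : nat,
     has_dim (@gr_comp k int (E_alg k p n) d%:Z) D /\
     D%:Z = \sum_(0 <= m < n.+1) N_coef p m d) /\
  (forall d : nat, exists D : nat,
     has_dim (@gr_comp k int (E_infty k p) d%:Z) D /\
     int_series_sum (fun m => N_coef p m d) D%:Z).
Proof.
split=> [|d]; first exact: dim_E_alg.
(* [N_coef p m d] vanishes for [m > d], so the dimension in degree [d] is constant from stage [d]
   on. *)
have N_stable n : (d <= n)%N ->
    \sum_(0 <= m < n.+1) N_coef p m d = \sum_(0 <= m < d.+1) N_coef p m d.
  move=> dn; rewrite (@big_cat_nat _ _ _ d.+1) //= [X in _ + X](_ : _ = 0) ?addr0 //.
  by rewrite big_nat big1 // => m /andP[dm _]; apply: N_coef_eq0.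
have [D [_ DE]] := @dim_E_alg k p p_prime d d.
exists D; split.
  apply: (@has_dim_colim _ _ _ _ (@E_incl_inj k p) _ d) => n dn.
  have [D' [dimD' D'E]] := @dim_E_alg k p p_prime n d.
  suff <- : D' = D by [].
  by apply/eqP; rewrite -eqz_nat D'E N_stable // DE.
(* The sum over [m < K] includes all [m <= d] once [K] reaches [d.+1]. *)
exists d.+1 => -[//|n] dn.
by rewrite -(big_mkord xpredT (fun m => N_coef p m d)) N_stable.
Qed.
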